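(* Let $\mathcal G$ be a finite groupoid and let $\delta$ be a right action of the commutative quantum groupoid $(C(\mathcal G),\Gamma_{\mathcal G},\kappa_{\mathcal G})$ on a von Neumann module $(A,b)$. Let $\hat\delta$ be the dual coaction on the crossed product $A\rtimes_\delta C(\mathcal G)$. Then the double crossed product $(A\rtimes_\delta C(\mathcal G))\,\hat\rtimes_{\hat\delta}\,\mathcal R(\mathcal G)$ is isomorphic (as a von Neumann algebra) to $\delta(1)\,(A\otimes\mathcal W(\mathcal G))\,\delta(1)$, where $\mathcal W(\mathcal G)$ (the Weyl algebra of $C(\mathcal G)$) is the commutant in $\mathcal L(l^2(\mathcal G))$ of the algebra of multiplication operators by the functions $f\circ r$, $f\in l^\infty(\mathcal G^0)$; $\mathcal W(\mathcal G)$ is also the von Neumann subalgebra of $\mathcal L(l^2(\mathcal G))$ generated by $C(\mathcal G)$ and $\mathcal R(\mathcal G)$.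
   Context: $\mathcal G$ is a finite groupoid with unit space $\mathcal G^0$, source $s$ and range $r$; $xy$ is defined iff $s(x)=r(y)$. $C(\mathcal G)$ acts on $l^2(\mathcal G)$ by multiplication. For $x\in\mathcal G$, $\rho(x)$ is the partial isometry $(\rho(x)\xi)(t)=\xi(tx)$ if $s(t)=r(x)$ and $0$ otherwise; $\mathcal R(\mathcal G)=\mathrm{span}\{\rho(x):x\in\mathcal G\}$. The quantum groupoid $(C(\mathcal G),\Gamma_{\mathcal G},\kappa_{\mathcal G})$ has $\Gamma_{\mathcal G}(f)(x,y)=f(xy)$ if $x,y$ are composable and $0$ otherwise, and $\kappa_{\mathcal G}(f)(x)=f(x^{-1})$. Its target Cartan subalgebra is $S_t=\{f\circ r: f\in C(\mathcal G^0)\}\cong C(\mathcal G^0)$. Right action: let $A$ be a von Neumann algebra and $b:C(\mathcal G^0)\to A$ a unital faithful representation. Put $e_{b,i}=\sum_{u\in\mathcal G^0}b(\chi_u)\otimes\chi_{r^{-1}(u)}\in A\otimes C(\mathcal G)$. A right action of $(C(\mathcal G),\Gamma_{\mathcal G},\kappa_{\mathcal G})$ on $(A,b)$ is an injective normal (not necessarily unital) $*$-homomorphism $\delta:A\to A\otimes C(\mathcal G)$ with $(\delta\otimes i)\delta=(i\otimes\Gamma_{\mathcal G})\delta$ and $\delta(b(f))=e_{b,i}(1\otimes (f\circ s))$ for all $f\in C(\mathcal G^0)$. In particular $\delta(1)=e_{b,i}$. Crossed product: $A\rtimes_\delta C(\mathcal G)$ is the von Neumann subalgebra of $e_{b,i}(A\otimes\mathcal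 L(l^2(\mathcal G)))e_{b,i}$ generated by $\delta(A)$ and $e_{b,i}(1\otimes\mathcal R(\mathcal G))$; its unit is $e_{b,i}$. Dual coaction: let $\tilde I$ be the partial isometry of $l^2(\mathcal G\times\mathcal G)$ given by $\tilde I\xi(x,y)=\xi(x,yx^{-1})$ if $s(x)=s(y)$ and $0$ otherwise. For $z\in A\rtimes_\delta C(\mathcal G)$ put $\hat\delta(z)=\tilde I_{23}(z\otimes1)\tilde I_{23}^*\in (A\rtimes_\delta C(\mathcal G))\otimes\mathcal R(\mathcal G)$. Thus, with $e=\sum_{u}\chi_{s^{-1}(u)}\otimes\chi_{s^{-1}(u)}$, $\hat\delta(\delta(a))=(1\otimes e)(\delta(a)\otimes1)$ and $\hat\delta(e_{b,i}(1\otimes\rho(x)))=(e_{b,i}\otimes1)(1\otimes\rho(x)\otimes\rho(x))$. Double crossed product: $(A\rtimes_\delta C(\mathcal G))\,\hat\rtimes_{\hat\delta}\,\mathcal R(\mathcal G)$ is the von Neumann subalgebra of $\hat\delta(1)\big((A\rtimes_\delta C(\mathcal G))\otimes\mathcal L(l^2(\mathcal G))\big)\hat\delta(1)$ generated by $\hat\delta(A\rtimes_\delta C(\mathcal G))$ and $\hat\delta(1)(1\otimes C(\mathcal G))$, where $\hat\delta(1)$ denotes the image of the unit of $A\rtimes_\delta C(\mathcal G)$ (here $C(\mathcal G)$ equals its own commutant in $\mathcal L(l^2(\mathcal G))$). *)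

(* Defs.v *)
From HB Require Import structures.
From mathcomp Require Import all_boot all_order all_algebra.
From mathcomp Require Import complex.
From mathcomp Require Import all_classical all_reals.
From mathcomp Require Import ring lra.
From mathcomp Require Import topology normedtype sequences.

Set Implicit Arguments.
Unset Strict Implicit.
Unset Printing Implicit Defensive.

Import Order.TTheory GRing.Theory Num.Theory.
Import numFieldNormedType.Exports.

Local Open Scope classical_set_scope.
Local Open Scope ring_scope.

HB.mixin Record Lmodule_isHilbert (R : realType) V of GRing.Lmodule R[i] V := {
  dot : V -> V -> R[i] ;
  dotPl : forall (a : R[i]) (u v w : V), dot (a *: u + v) w = a * dot u w + dot v w ;
  dotC : forall u v : V, dot u v = ((dot v u)^*)%C ;
  dot_ge0 : forall u : V, 0 <= dot u u ;
  dot_eq0 : forall u : V, dot u u = 0 -> u = 0 ;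
  dot_complete : forall u : nat -> V,
    (forall e : R, 0 < e -> exists N : nat, forall m n : nat, (N <= m)%N -> (N <= n)%N ->
       complex.Re (dot (u m - u n) (u m - u n)) < e) ->
    exists l : V,
      (fun n => complex.Re (dot (u n - l) (u n - l))) @ \oo --> (0 : R)
}.

#[short(type="hilbertType")]
HB.structure Definition Hilbert (R : realType) :=
  {V of Lmodule_isHilbert R V & GRing.Lmodule R[i] V}.

Section ComplexHilbert.
Variable R : realType.

Let cdot (x y : R[i]^o) : R[i] := x * ((y : R[i])^*)%C.

Let Re_cdot (x : R[i]^o) :
  complex.Re (cdot x x) = complex.Re x ^+ 2 + complex.Im x ^+ 2.
Proof. by case: x => a b; rewrite /cdot /= !expr2 mulrN opprK. Qed.

Fact cdotPl (a : R[i]) (u v w : R[i]^o) :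
  cdot (a *: u + v) w = a * cdot u w + cdot v w.
Proof. by rewrite /cdot mulrDl -mulrA. Qed.

Fact cdotC (u v : R[i]^o) : cdot u v = ((cdot v u)^*)%C.
Proof. rewrite /cdot; case: u v => [a b] [c d]; apply/eqP; rewrite eq_complex /=.
by apply/andP; split; apply/eqP; ring. Qed.

Fact cdot_ge0 (u : R[i]^o) : 0 <= cdot u u.
Proof.
rewrite lecE Re_cdot; apply/andP; split; last by rewrite addr_ge0 ?sqr_ge0.
by case: u => a b; rewrite /cdot /= mulrN mulrC addNr.
Qed.

Fact cdot_eq0 (u : R[i]^o) : cdot u u = 0 -> u = 0.
Proof.
move=> u0; have : complex.Re (cdot u u) = 0 by rewrite u0.
rewrite Re_cdot => /eqP; rewrite paddr_eq0 ?sqr_ge0 // !sqrf_eq0.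
by case: u u0 => a b _ /= /andP[/eqP -> /eqP ->].
Qed.

Let sqr_cauchy_cvg (p : nat -> R) :
  (forall e : R, 0 < e -> exists N : nat, forall m n : nat, (N <= m)%N -> (N <= n)%N ->
     (p m - p n) ^+ 2 < e) ->
  exists l : R, (fun n => (p n - l) ^+ 2) @ \oo --> (0 : R).
Proof.
move=> pC.
have /cvg_ex[l pl] : cvg (p @ \oo).
  apply/cauchy_cvgP/cauchy_exP => e e0.
  have [N pN] := pC _ (exprn_gt0 2 e0).
  exists (p N); exists N => // n /= Nn.
  rewrite /ball /= -(ltr_pXn2r (n := 2))// ?nnegrE ?(ltW e0)//.
  by rewrite -normrX ger0_norm ?sqr_ge0// pN.
exists l; rewrite -[0](mul0r (l - l)) -{1}(subrr l).
under eq_fun do rewrite expr2.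
by apply: cvgM; apply: cvgB => //; exact: cvg_cst.
Qed.

Fact cdot_complete (u : nat -> R[i]^o) :
  (forall e : R, 0 < e -> exists N : nat, forall m n : nat, (N <= m)%N -> (N <= n)%N ->
     complex.Re (cdot (u m - u n) (u m - u n)) < e) ->
  exists l : R[i]^o,
    (fun n => complex.Re (cdot (u n - l) (u n - l))) @ \oo --> (0 : R).
Proof.
move=> uC.
have [|a al] := @sqr_cauchy_cvg (fun n => complex.Re (u n)).
  move=> e /uC[N uN]; exists N => m n Nm Nn.
  apply: le_lt_trans (uN _ _ Nm Nn); rewrite Re_cdot.
  by case: (u m) (u n) => [? ?] [? ?] /=; rewrite lerDl sqr_ge0.
have [|b bl] := @sqr_cauchy_cvg (fun n => complex.Im (u n)).
  move=> e /uC[N uN]; exists N => m n Nm Nn.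
  apply: le_lt_trans (uN _ _ Nm Nn); rewrite Re_cdot.
  by case: (u m) (u n) => [? ?] [? ?] /=; rewrite lerDr sqr_ge0.
exists (a +i* b)%C; rewrite -(addr0 0).
under eq_fun => n.
  rewrite Re_cdot (_ : complex.Re _ = complex.Re (u n) - a); last by case: (u n).
  rewrite (_ : complex.Im _ = complex.Im (u n) - b); last by case: (u n).
  over.
exact: cvgD al bl.
Qed.

HB.instance Definition _ := Lmodule_isHilbert.Build R (R[i]^o)
  cdotPl cdotC cdot_ge0 cdot_eq0 cdot_complete.

End ComplexHilbert.

(* {ffun X -> H} is the Hilbert tensor product of H and l^2(X), the vector
   [ffun x => a x *: h] being h tensor a. *)
Section HilbertSum.
Variables (R : realType) (H : hilbertType R) (X : finType).
Implicit Types u v w : {ffun X -> H}.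

Let sdot u v : R[i] := \sum_x dot (u x) (v x).

Fact sdotPl (a : R[i]) u v w : sdot (a *: u + v) w = a * sdot u w + sdot v w.
Proof.
rewrite /sdot mulr_sumr -big_split /=; apply: eq_bigr => x _.
by rewrite !ffunE dotPl.
Qed.

Fact sdotC u v : sdot u v = ((sdot v u)^*)%C.
Proof. by rewrite /sdot rmorph_sum; apply: eq_bigr => x _; exact: dotC. Qed.

Fact sdot_ge0 u : 0 <= sdot u u.
Proof. by apply: sumr_ge0 => x _; exact: dot_ge0. Qed.

Fact sdot_eq0 u : sdot u u = 0 -> u = 0.
Proof.
move=> /eqP; rewrite psumr_eq0 => [/allP u0|x _]; last exact: dot_ge0.
apply/ffunP => x; rewrite ffunE; apply: dot_eq0; apply/eqP.
exact: u0 (mem_index_enum x).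
Qed.

Let Re_sdot u : complex.Re (sdot u u) = \sum_x complex.Re (dot (u x) (u x)).
Proof. by apply: (big_morph (@complex.Re R)) => // -[a b] [c d]. Qed.

Fact sdot_complete (u : nat -> {ffun X -> H}) :
  (forall e : R, 0 < e -> exists N : nat, forall m n : nat, (N <= m)%N -> (N <= n)%N ->
     complex.Re (sdot (u m - u n) (u m - u n)) < e) ->
  exists l : {ffun X -> H},
    (fun n => complex.Re (sdot (u n - l) (u n - l))) @ \oo --> (0 : R).
Proof.
move=> uC.
have Re_ge0 (h : H) : 0 <= complex.Re (dot h h).
  by have := dot_ge0 h; rewrite lecE => /andP[].
have /(_ _)/cid-/all_sig[l ul] x : exists l : H,
    (fun n => complex.Re (dot (u n x - l) (u n x - l))) @ \oo --> (0 : R).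
  apply: dot_complete => e /uC[N uN]; exists N => m n Nm Nn.
  apply: le_lt_trans (uN _ _ Nm Nn); rewrite Re_sdot (bigD1 x)//= !ffunE.
  by rewrite lerDl sumr_ge0.
exists [ffun x => l x].
under eq_fun => n.
  rewrite Re_sdot; under eq_bigr do rewrite !ffunE; over.
elim: (index_enum X) => [|x s IHs].
  by under eq_fun do rewrite big_nil; exact: cvg_cst.
under eq_fun do rewrite big_cons.
by have := cvgD (ul x) IHs; rewrite addr0; exact.
Qed.

HB.instance Definition _ := Lmodule_isHilbert.Build R {ffun X -> H}
  sdotPl sdotC sdot_ge0 sdot_eq0 sdot_complete.

End HilbertSum.

Section Operators.
Variable R : realType.
Implicit Types H K : hilbertType R.

Definition hnorm H (u : H) : R := Num.sqrt (complex.Re (dot u u)).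

Definition bounded_op H : set (H -> H) :=
  [set T | (forall (a : R[i]) (u v : H), T (a *: u + v) = a *: T u + T v) /\
           exists M : R, forall u : H, hnorm (T u) <= M * hnorm u].

Definition is_adjoint H (T S : H -> H) : Prop :=
  forall u v : H, dot (T u) v = dot u (S v).

Definition square_summable H (xi : nat -> H) : Prop :=
  cvgn (series (fun n => hnorm (xi n) ^+ 2)).

Definition vec_functional H (xi eta : nat -> H) (T : H -> H) : R[i]^o :=
  limn (series (fun n => (dot (T (xi n)) (eta n) : R[i]^o))).

(* Convergence of a filter for the sigma-weak (ultraweak) topology, i.e. the
   initial topology for the functionals T |-> sum_n <T xi_n, eta_n>. *)
Definition sweak_cvg H (F : set_system (H -> H)) (T : H -> H) : Prop :=
  forall xi eta : nat -> H, square_summable xi -> square_summable eta ->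
    vec_functional xi eta @ F --> vec_functional xi eta T.

Record star_subalgebra H (M : set (H -> H)) : Prop := StarSubalgebra {
  star_bounded : M `<=` @bounded_op H ;
  star0 : M 0 ;
  starD : forall S T, M S -> M T -> M (S + T) ;
  starZ : forall (a : R[i]) T, M T -> M (a *: T) ;
  starM : forall S T, M S -> M T -> M (S \o T) ;
  star_adj : forall T, M T -> exists2 S, M S & is_adjoint T S
}.

Definition sweak_closed H (M : set (H -> H)) : Prop :=
  forall F : set_system (H -> H), ProperFilter F -> F M ->
    forall T, bounded_op T -> sweak_cvg F T -> M T.

(* The unit of M may be a proper projection (M may be degenerate on H), as is
   the case for crossed products and for corners. *)
Definition vn_subalgebra H (M : set (H -> H)) : Prop :=
  star_subalgebra M /\ sweak_closed M.

Definition vn_algebra H (M : set (H -> H)) : Prop :=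
  vn_subalgebra M /\ M idfun.

Definition vn_generated H (S : set (H -> H)) : set (H -> H) :=
  smallest (@vn_subalgebra H) S.

Definition commutant H (S : set (H -> H)) : set (H -> H) :=
  [set T | bounded_op T /\ forall U, S U -> T \o U = U \o T].

Definition corner H (e : H -> H) (M : set (H -> H)) : set (H -> H) :=
  [set e \o T \o e | T in M].

Record star_hom H K (M : set (H -> H)) (N : set (K -> K))
    (phi : (H -> H) -> (K -> K)) : Prop := StarHom {
  hom_fun : forall T, M T -> N (phi T) ;
  homD : forall S T, M S -> M T -> phi (S + T) = phi S + phi T ;
  homZ : forall (a : R[i]) T, M T -> phi (a *: T) = a *: phi T ;
  homM : forall S T, M S -> M T -> phi (S \o T) = phi S \o phi T ;
  hom_adj : forall S T, M S -> M T ->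
    is_adjoint S T -> is_adjoint (phi S) (phi T)
}.

Definition normal_on H K (M : set (H -> H)) (phi : (H -> H) -> (K -> K)) : Prop :=
  forall F : set_system (H -> H), ProperFilter F -> F M ->
    forall T, M T -> sweak_cvg F T -> sweak_cvg (phi @ F) (phi T).

Definition vn_isomorphic H K (M : set (H -> H)) (N : set (K -> K)) : Prop :=
  exists (phi : (H -> H) -> (K -> K)) (psi : (K -> K) -> (H -> H)),
    [/\ star_hom M N phi, normal_on M phi, star_hom N M psi, normal_on N psi &
        (forall T, M T -> psi (phi T) = T) /\ (forall T, N T -> phi (psi T) = T)].

End Operators.

Section TensorProducts.
Variables (R : realType) (X : finType).
Implicit Types H K : hilbertType R.

Definition l2 : hilbertType R := {ffun X -> R[i]^o}.

Definition basis_vec (x : X) : l2 := [ffun y => (y == x)%:R].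

Definition mulop (f : X -> R[i]) : l2 -> l2 := fun xi => [ffun x => f x * xi x].

Definition mult_algebra : set (l2 -> l2) := range mulop.

Definition munit (x y : X) : l2 -> l2 := fun xi => xi y *: basis_vec x.

Definition tens H (a : H -> H) (w : l2 -> l2) : {ffun X -> H} -> {ffun X -> H} :=
  fun xi => [ffun x => \sum_y w (basis_vec y) x *: a (xi y)].

Definition vn_tensor H (M : set (H -> H)) (N : set (l2 -> l2)) :
    set ({ffun X -> H} -> {ffun X -> H}) :=
  vn_generated [set tens a w | a in M & w in N].

(* entry T x y is the (x, y) coefficient of T:
   T = \sum_x \sum_y tens (entry T x y) (munit x y). *)
Definition entry H (T : {ffun X -> H} -> {ffun X -> H}) (x y : X) : H -> H :=
  fun h => T [ffun z => if z == y then h else 0] x.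

Definition hom_tens_id H K (phi : (H -> H) -> (K -> K))
    (T : {ffun X -> H} -> {ffun X -> H}) : {ffun X -> K} -> {ffun X -> K} :=
  \sum_x \sum_y tens (phi (entry T x y)) (munit x y).

End TensorProducts.

Arguments mult_algebra R X : clear implicits.

(* gmul x y is the product xy when gsrc x = grng y, and junk otherwise. *)
Record finGroupoid := FinGroupoid {
  gobj : finType ;
  garr :> finType ;
  gsrc : garr -> gobj ;
  grng : garr -> gobj ;
  gid : gobj -> garr ;
  ginv : garr -> garr ;
  gmul : garr -> garr -> garr ;
  gsrc_id : forall u, gsrc (gid u) = u ;
  grng_id : forall u, grng (gid u) = u ;
  gsrc_inv : forall x, gsrc (ginv x) = grng x ;
  grng_inv : forall x, grng (ginv x) = gsrc x ;
  gsrc_mul : forall x y, gsrc x = grng y -> gsrc (gmul x y) = gsrc y ;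
  grng_mul : forall x y, gsrc x = grng y -> grng (gmul x y) = grng x ;
  gmulA : forall x y z, gsrc x = grng y -> gsrc y = grng z ->
    gmul x (gmul y z) = gmul (gmul x y) z ;
  gmul1l : forall x, gmul (gid (grng x)) x = x ;
  gmul1r : forall x, gmul x (gid (gsrc x)) = x ;
  gmulV : forall x, gmul x (ginv x) = gid (grng x) ;
  gmulVl : forall x, gmul (ginv x) x = gid (gsrc x)
}.

Section Groupoid.
Variables (R : realType) (G : finGroupoid).
Local Notation s := (@gsrc G).
Local Notation r := (@grng G).

Definition chi (X : eqType) (x : X) : X -> R[i] := fun y => (y == x)%:R.

Definition rho (x : G) : l2 R G -> l2 R G :=
  fun xi => [ffun t => if s t == r x then xi (gmul t x) else 0].

Definition rho_algebra : set (l2 R G -> l2 R G) :=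
  [set T | exists c : G -> R[i], T = \sum_x c x *: rho x].

Definition comult (f : G -> R[i]) (x y : G) : R[i] :=
  if s x == r y then f (gmul x y) else 0.

Definition weyl_algebra : set (l2 R G -> l2 R G) :=
  commutant [set mulop (f \o r) | f in [set: gobj G -> R[i]]].

Section Action.
Variables (H : hilbertType R) (A : set (H -> H)).
Variable b : (gobj G -> R[i]) -> (H -> H).
Variable delta : (H -> H) -> ({ffun G -> H} -> {ffun G -> H}).

Record unital_faithful_rep : Prop := UnitalFaithfulRep {
  rep_in : forall f, A (b f) ;
  repD : forall f g, b (f \+ g) = b f + b g ;
  repZ : forall (a : R[i]) f, b (fun u => a * f u) = a *: b f ;
  repM : forall f g, b (f \* g) = b f \o b g ;
  rep_adj : forall f, is_adjoint (b f) (b (fun u => ((f u)^*)%C)) ;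
  rep1 : b (fun=> 1) = idfun ;
  rep_inj : injective b
}.

Definition e_bi : {ffun G -> H} -> {ffun G -> H} :=
  \sum_(u : gobj G) tens (b (chi u)) (mulop (chi u \o r)).

(* Vectors of H tensor l^2(G) tensor l^2(G) are encoded as
   xi : {ffun G -> {ffun G -> H}}, the coordinate of xi at (x, y) in G x G being
   xi y x: the last leg is the outer index. *)

(* (i tensor Gamma)(T) for T = \sum_z T_z tensor chi_z in A tensor C(G). *)
Definition id_tens_comult (T : {ffun G -> H} -> {ffun G -> H}) :
    {ffun G -> {ffun G -> H}} -> {ffun G -> {ffun G -> H}} :=
  fun xi => [ffun y => [ffun x =>
    \sum_z comult (chi z) x y *: entry T z z (xi y x)]].

Record right_action : Prop := RightAction {
  action_hom : star_hom A (vn_tensor A (mult_algebra R G)) delta ;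
  action_inj : {in A &, injective delta} ;
  action_normal : normal_on A delta ;
  action_coassoc : forall a, A a ->
    hom_tens_id delta (delta a) = id_tens_comult (delta a) ;
  action_unit : forall f : gobj G -> R[i],
    delta (b f) = e_bi \o tens idfun (mulop (f \o s))
}.

Definition crossed_product : set ({ffun G -> H} -> {ffun G -> H}) :=
  vn_generated (delta @` A `|` [set e_bi \o tens idfun w | w in rho_algebra]).

(* 1_H tensor I, where (I xi)(x, y) = xi(x, y x^-1) if s x = s y and 0 otherwise,
   and its adjoint (see I23_adjP). *)
Definition I23 (xi : {ffun G -> {ffun G -> H}}) : {ffun G -> {ffun G -> H}} :=
  [ffun y => [ffun x => if s x == s y then xi (gmul y (ginv x)) x else 0]].

Definition I23_adj (xi : {ffun G -> {ffun G -> H}}) : {ffun G -> {ffun G -> H}} :=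
  [ffun y => [ffun x => if s y == r x then xi (gmul y x) x else 0]].

Lemma I23_adjP : is_adjoint I23 I23_adj.
Proof.
have dot0l (h : H) : dot 0 h = 0.
  by have := dotPl 1 0 0 h; rewrite scaler0 addr0 mul1r => /(canLR (addrK _)); rewrite subrr.
have dot0r (h : H) : dot h 0 = 0 by rewrite dotC dot0l conjc0.
move=> u v; rewrite {1}/dot /= [RHS]/dot /=.
under eq_bigr do rewrite {1}/dot /=.
under [RHS]eq_bigr do rewrite {1}/dot /=.
rewrite exchange_big [RHS]exchange_big /=; apply: eq_bigr => x _.
transitivity (\sum_(y | s y == s x) dot (u (gmul y (ginv x)) x) (v y x)).
  rewrite [RHS]big_mkcond; apply: eq_bigr => y _; rewrite !ffunE eq_sym.
  by case: ifP => _; rewrite ?dot0l.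
transitivity (\sum_(z | s z == r x) dot (u z x) (v (gmul z x) x)); last first.
  rewrite big_mkcond; apply: eq_bigr => z _; rewrite !ffunE.
  by case: ifP => _; rewrite ?dot0r.
have mulK z : s z = r x -> gmul (gmul z x) (ginv x) = z.
  by move=> zx; rewrite -gmulA ?grng_inv// gmulV -zx gmul1r.
rewrite (reindex_onto (fun z => gmul z x) (fun y => gmul y (ginv x))) /=; last first.
  by move=> y /eqP yx; rewrite -gmulA ?grng_inv ?gsrc_inv// gmulVl -yx gmul1r.
apply: eq_big => [z|z /andP[_ /eqP ->]//].
apply/andP/eqP => [[/eqP sz /eqP <-]|zx]; last by rewrite gsrc_mul// mulK.
by rewrite gsrc_mul ?gsrc_inv// grng_inv sz.
Qed.

Definition dual_coaction (z : {ffun G -> H} -> {ffun G -> H}) :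
    {ffun G -> {ffun G -> H}} -> {ffun G -> {ffun G -> H}} :=
  I23 \o tens z idfun \o I23_adj.

Definition double_crossed_product :
    set ({ffun G -> {ffun G -> H}} -> {ffun G -> {ffun G -> H}}) :=
  vn_generated (dual_coaction @` crossed_product `|`
    [set dual_coaction e_bi \o tens idfun w | w in mult_algebra R G]).

End Action.
End Groupoid.

Arguments rho_algebra R G : clear implicits.
Arguments weyl_algebra R G : clear implicits.

(* Main.v *)
Require Import Defs.
From HB Require Import structures.
From mathcomp Require Import all_boot all_order all_algebra.
From mathcomp Require Import complex.
From mathcomp Require Import all_classical all_reals.
From mathcomp Require Import ring lra.
From mathcomp Require Import topology normedtype sequences.

(** Decompose delta(a) along the arrows of G as a diagonal family of operators
delta_x(a), written [translate x a] below, and let p_u = b(chi_u), written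
[proj u].  Coassociativity says that delta_x delta_y is delta_{xy} when xy is
defined and 0 otherwise, and the condition on delta(b(f)) says that
delta_x(p_u) is p_{r x} if u = s x and 0 otherwise.  Since delta is injective
this forces a = sum_u delta_{id u}(a), hence p_u a = delta_{id u}(a) = a p_u
([proj_comp], [comp_proj]): the p_u are central, and delta_x transports the
summand A p_{s x} to the summand A p_{r x}.

The corner delta(1)(A tensor W)delta(1) is then the algebra C of all matrices
indexed by G whose (y, y') entry lies in p_{r y} A p_{r y'} ([cornerE]); the
entries with r y <> r y' vanish because distinct p_u are orthogonal and
central.

On H tensor l^2(G) tensor l^2(G), the substitution (x, y) = (w y, y), which
makes sense for s w = r y, identifies the range of I with H tensor l^2 of the
composable pairs (w, y), and turns the dual coaction of z into the operator
(delta tensor i)(z).  This formula makes sense on all of C and defines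
[dual_hom], sum over y, y' of U_y^adj delta(T_{y,y'}) U_{y'}, where U_y
([slice]) picks the coordinates (w y, y) of a vector.  It is multiplicative
since U_y U_{y'}^adj is 0 for y <> y' and otherwise the projection onto the w
with s w = r y, on which delta(p_{r y} A) lives.  It is undone by
[compress], which looks only at w = id, that is at the coordinates (y, y):
delta_{id} is the identity on p_{r y} A.

Everything in sight is sigma-weakly continuous: the maps are finite sums of
sandwiches P T Q, matrix entries, and the normal map delta.  Hence the image
of C is a von Neumann algebra ([dual_hom_image_vn]), and the operators of C on
which [dual_hom] agrees with the dual coaction form one too.  The latter
contains the generators of the crossed product, hence the crossed product
itself ([crossed_product_corner]); as [dual_hom] also maps e(1 tensor f) to
the remaining generators of the double crossed product, the double crossed
product is contained in the image of C.  Conversely, for r x = r y a matrix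
c tensor e_{x,y} in C is the product of e(1 tensor chi_x),
delta(delta_{x^-1}(c)) and e(1 tensor rho(x^-1 y)) ([corner_matrix_unit]), all
of which are sent to generators.  So [dual_hom] is an isomorphism of C onto the
double crossed product.

The same factorisation e_{x,y} = chi_x rho(x^-1 y) of matrix units shows that
C(G) and R(G) generate W(G) ([weyl_generated]). *)

Set Implicit Arguments.
Unset Strict Implicit.
Unset Printing Implicit Defensive.
Import Order.TTheory GRing.Theory Num.Theory.
Import numFieldNormedType.Exports.
Local Open Scope classical_set_scope.
Local Open Scope ring_scope.

(** * Inner products and bounded maps *)
Section InnerProduct.
Variables (R : realType) (H : hilbertType R).
Implicit Types u v w : H.

Lemma dot0l u : dot 0 u = 0.
Proof.
have := dotPl 1 0 0 u.
by rewrite scaler0 addr0 mul1r => /(canLR (addrK _)); rewrite subrr.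
Qed.

Lemma dot0r u : dot u 0 = 0.
Proof. by rewrite dotC dot0l conjc0. Qed.

Lemma dotDl u v w : dot (u + v) w = dot u w + dot v w.
Proof. by rewrite -[u in LHS]scale1r dotPl mul1r. Qed.

Lemma dotZl a u w : dot (a *: u) w = a * dot u w.
Proof. by rewrite -[_ *: u]addr0 dotPl dot0l addr0. Qed.

Lemma dotDr u v w : dot u (v + w) = dot u v + dot u w.
Proof. by rewrite dotC dotDl rmorphD /= -!dotC. Qed.

Lemma dotZr a u w : dot u (a *: w) = (a^*)%C * dot u w.
Proof. by rewrite dotC dotZl rmorphM /= -dotC. Qed.

Lemma dotNl u w : dot (- u) w = - dot u w.
Proof. by rewrite -scaleN1r dotZl mulN1r. Qed.

Lemma dotNr u w : dot u (- w) = - dot u w.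
Proof. by rewrite dotC dotNl rmorphN /= -dotC. Qed.

Lemma dot_suml (I : Type) (s : seq I) (P : pred I) (F : I -> H) w :
  dot (\sum_(i <- s | P i) F i) w = \sum_(i <- s | P i) dot (F i) w.
Proof.
by apply: (big_morph (fun u => dot u w)) => [u v|]; rewrite ?dotDl ?dot0l.
Qed.

Lemma dot_sumr (I : Type) (s : seq I) (P : pred I) (F : I -> H) w :
  dot w (\sum_(i <- s | P i) F i) = \sum_(i <- s | P i) dot w (F i).
Proof.
by apply: (big_morph (fun u => dot w u)) => [u v|]; rewrite ?dotDr ?dot0r.
Qed.

(** The main device for proving equalities of operators given only by their
matrix coefficients. *)
Lemma dot_inj u v : (forall w, dot u w = dot v w) -> u = v.
Proof.
move=> uv; apply/eqP; rewrite -subr_eq0; apply/eqP/dot_eq0.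
by rewrite dotDl dotNl uv subrr.
Qed.

(** The squared norm avoids square roots throughout: boundedness and
square-summability are both stated in terms of it. *)
Definition sqnorm u : R := complex.Re (dot u u).

Lemma sqnorm_ge0 u : 0 <= sqnorm u.
Proof. by have := dot_ge0 u; rewrite lecE => /andP[]. Qed.

Lemma hnorm_sq u : hnorm u ^+ 2 = sqnorm u.
Proof. by rewrite sqr_sqrtr ?sqnorm_ge0. Qed.

Lemma sqnorm0 : sqnorm 0 = 0.
Proof. by rewrite /sqnorm dot0l. Qed.

Lemma sqnormD u v :
  sqnorm (u + v) = sqnorm u + sqnorm v + 2 * complex.Re (dot u v).
Proof.
rewrite /sqnorm dotDl !dotDr [dot v u]dotC !raddfD /=.
by case: (dot u v) => a c /=; ring.
Qed.

Lemma sqnormN u : sqnorm (- u) = sqnorm u.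
Proof. by rewrite /sqnorm dotNl dotNr opprK. Qed.

Lemma sqnormZ a u :
  sqnorm (a *: u) = (complex.Re a ^+ 2 + complex.Im a ^+ 2) * sqnorm u.
Proof.
have u0 := ger0_Im (dot_ge0 u).
rewrite /sqnorm dotZl dotZr mulrA; case: a => a c.
by case: (dot u u) u0 => x y /= ->; ring.
Qed.

Lemma sqnormD_le u v : sqnorm (u + v) <= 2 * (sqnorm u + sqnorm v).
Proof.
have := sqnorm_ge0 (u - v); rewrite !sqnormD sqnormN dotNr.
by case: (dot u v) => a c /=; lra.
Qed.

(** A weak form of the Cauchy-Schwarz inequality, sharp enough to dominate the
series of coefficients by a convergent one; it comes from u + v and u - v
having nonnegative squared norm. *)
Lemma normr_Re_dot u v : `|complex.Re (dot u v)| <= sqnorm u + sqnorm v.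
Proof.
have := sqnorm_ge0 (u + v); have := sqnorm_ge0 (u - v).
have := sqnorm_ge0 u; have := sqnorm_ge0 v.
rewrite !sqnormD sqnormN dotNr.
by rewrite ler_norml; case: (dot u v) => a c /=; lra.
Qed.

(** The imaginary part of <u, v> is minus the real part of <iu, v>. *)
Lemma normr_Im_dot u v : `|complex.Im (dot u v)| <= sqnorm u + sqnorm v.
Proof.
have := normr_Re_dot ('i%C *: u) v; rewrite sqnormZ /= expr0n expr1n add0r mul1r.
by rewrite dotZl; case: (dot u v) => a c /=; rewrite mul0r mul1r sub0r normrN.
Qed.

End InnerProduct.

Section BoundedMaps.
Variable R : realType.
Implicit Types H K L : hilbertType R.

Definition linear_map H K (Q : H -> K) :=
  forall a u v, Q (a *: u + v) = a *: Q u + Q v.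

(** Unlike [bounded_op], for maps between possibly different spaces and without
linearity. *)
Definition bounded_map H K (Q : H -> K) :=
  exists M : R, forall u, sqnorm (Q u) <= M * sqnorm u.

Lemma linear_map0 H K (Q : H -> K) : linear_map Q -> Q 0 = 0.
Proof.
move=> /(_ 1 0 0); rewrite !scale1r addr0 => /(canLR (addrK _)).
by rewrite subrr.
Qed.

Lemma linear_mapD H K (Q : H -> K) u v : linear_map Q -> Q (u + v) = Q u + Q v.
Proof. by move=> /(_ 1 u v); rewrite !scale1r. Qed.

Lemma linear_mapZ H K (Q : H -> K) a u : linear_map Q -> Q (a *: u) = a *: Q u.
Proof. by move=> lQ; rewrite -[_ *: u]addr0 lQ (linear_map0 lQ) addr0. Qed.

Lemma linear_map_sum H K (Q : H -> K) (I : Type) (s : seq I) (F : I -> H) :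
  linear_map Q -> Q (\sum_(i <- s) F i) = \sum_(i <- s) Q (F i).
Proof.
move=> lQ; apply: (big_morph Q) => [u v|]; first exact: linear_mapD.
exact: linear_map0.
Qed.

Lemma bounded_mapP H K (Q : H -> K) : bounded_map Q ->
  exists2 M : R, 0 <= M & forall u, sqnorm (Q u) <= M * sqnorm u.
Proof.
move=> [M QM]; exists (Num.max M 0) => [|u]; first by rewrite le_max lexx orbT.
by apply: le_trans (QM u) _; rewrite ler_wpM2r ?sqnorm_ge0// le_max lexx.
Qed.

Lemma bounded_opE H (T : H -> H) :
  bounded_op T <-> linear_map T /\ bounded_map T.
Proof.
split=> -[lT].
  move=> [M TM]; split=> //; exists (M ^+ 2) => u.
  rewrite -!hnorm_sq -exprMn; apply: lerXn2r (TM u); rewrite nnegrE ?sqrtr_ge0//.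
  exact: le_trans (sqrtr_ge0 _) (TM u).
move=> /bounded_mapP[M M0 TM]; split=> //; exists (Num.sqrt M) => u.
by rewrite /hnorm -sqrtrM// ler_sqrt ?TM// mulr_ge0 ?sqnorm_ge0.
Qed.

Lemma bounded_map0 H K : bounded_map (fun _ : H => 0 : K).
Proof. by exists 0 => u; rewrite sqnorm0 mul0r. Qed.

Lemma bounded_mapD H K (Q Q' : H -> K) :
  bounded_map Q -> bounded_map Q' -> bounded_map (fun u => Q u + Q' u).
Proof.
move=> [M QM] [M' QM']; exists (2 * (M + M')) => u.
apply: le_trans (sqnormD_le _ _) _; rewrite -mulrA ler_wpM2l// mulrDl.
exact: lerD.
Qed.

Lemma bounded_mapZ H K (Q : H -> K) a :
  bounded_map Q -> bounded_map (fun u => a *: Q u).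
Proof.
move=> [M QM]; exists ((complex.Re a ^+ 2 + complex.Im a ^+ 2) * M) => u.
by rewrite sqnormZ -mulrA ler_wpM2l// addr_ge0 ?sqr_ge0.
Qed.

Lemma bounded_map_comp H K L (Q : K -> L) (P : H -> K) :
  bounded_map Q -> bounded_map P -> bounded_map (fun u => Q (P u)).
Proof.
move=> /bounded_mapP[M M0 QM] [N PN]; exists (M * N) => u.
by apply: le_trans (QM _) _; rewrite -mulrA ler_wpM2l.
Qed.

Lemma bounded_map_sum H K (I : Type) (s : seq I) (Q : I -> H -> K) :
  (forall i, bounded_map (Q i)) -> bounded_map (fun u => \sum_(i <- s) Q i u).
Proof.
move=> bQ; elim: s => [|i s IHs].
  by under eq_fun do rewrite big_nil; exact: bounded_map0.
by under eq_fun do rewrite big_cons; exact: bounded_mapD.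
Qed.

Lemma sqnorm_ffun H (X : finType) (xi : {ffun X -> H}) :
  sqnorm xi = \sum_x sqnorm (xi x).
Proof. by apply: (big_morph (@complex.Re R)) => // -[a b] [c d]. Qed.

Lemma bounded_coord H (X : finType) (x : X) :
  bounded_map (fun xi : {ffun X -> H} => xi x).
Proof.
exists 1 => xi; rewrite mul1r sqnorm_ffun (bigD1 x)//= lerDl.
by apply: sumr_ge0 => y _; exact: sqnorm_ge0.
Qed.

Lemma bounded_map_ffun H K (X : finType) (Q : X -> H -> K) :
  (forall x, bounded_map (Q x)) ->
  bounded_map (fun u => [ffun x => Q x u] : {ffun X -> K}).
Proof.
move=> /(_ _)/cid-/all_sig[M QM].
exists (\sum_x M x) => u; rewrite sqnorm_ffun mulr_suml.
by apply: ler_sum => x _; rewrite ffunE.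
Qed.

Lemma bounded_map_if H K (c : bool) (Q : H -> K) :
  bounded_map Q -> bounded_map (fun u => if c then Q u else 0).
Proof. by case: c => // _; exact: bounded_map0. Qed.

End BoundedMaps.

Arguments bounded_coord {R H X} x.

(** * Sigma-weak convergence and normality *)
Section ComplexSeries.
Variable R : realType.

(** The norm of a complex number is controlled by its real and imaginary
parts, which reduces completeness of the complex numbers to that of R. *)
Lemma cvg_complex (u : nat -> R[i]^o) (a b : R) :
  (fun n => complex.Re (u n)) @ \oo --> a ->
  (fun n => complex.Im (u n)) @ \oo --> b ->
  u @ \oo --> ((a +i* b)%C : R[i]^o).
Proof.
move=> /cvgrPdist_lt ua /cvgrPdist_lt ub; apply/cvgrPdist_lt => e.
rewrite ltcE /= => /andP[/eqP e0 eRe].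
have e2 : 0 < complex.Re e / 2 by rewrite divr_gt0.
near=> n.
have na : `|a - complex.Re (u n)| < complex.Re e / 2 by near: n; exact: ua.
have nb : `|b - complex.Im (u n)| < complex.Re e / 2 by near: n; exact: ub.
rewrite ltcE normc_def /= e0 eqxx /= -(ltr_pXn2r (n := 2))// ?nnegrE ?sqrtr_ge0 ?ltW//.
rewrite sqr_sqrtr ?addr_ge0 ?sqr_ge0//.
case: (u n) na nb => x y /=; rewrite !ltr_norml => /andP[? ?] /andP[? ?].
by nra.
Unshelve. all: by end_near. Qed.

Lemma cvg_series_complex (u : nat -> R[i]^o) (v : nat -> R) :
  cvgn (series v) ->
  (forall n, `|complex.Re (u n)| <= v n) ->
  (forall n, `|complex.Im (u n)| <= v n) -> cvgn (series u).
Proof.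
move=> cv uRe uIm.
have cvgR (w : nat -> R) : (forall n, `|w n| <= v n) -> cvgn (series w).
  move=> wv; apply: normed_cvg; apply: series_le_cvg cv => // n.
    exact: normr_ge0.
  exact: le_trans (normr_ge0 _) (wv n).
have /cvg_ex[a ua] := cvgR _ uRe; have /cvg_ex[b ub] := cvgR _ uIm.
apply/cvg_ex; exists (a +i* b)%C; apply: cvg_complex.
  rewrite (_ : (fun n => _) = series (fun n => complex.Re (u n)))//.
  by apply/funext => n; rewrite /series /= (raddf_sum (@complex.Re R)).
rewrite (_ : (fun n => _) = series (fun n => complex.Im (u n)))//.
by apply/funext => n; rewrite /series /= (raddf_sum (@complex.Im R)).
Qed.

End ComplexSeries.

Section SigmaWeak.
Variable R : realType.
Implicit Types H K L : hilbertType R.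

Lemma square_summableE H (xi : nat -> H) :
  square_summable xi = cvgn (series (fun n => sqnorm (xi n))).
Proof.
by rewrite /square_summable; under eq_fun do rewrite hnorm_sq.
Qed.

Lemma square_summable_map H K (Q : H -> K) (xi : nat -> H) :
  bounded_map Q -> square_summable xi -> square_summable (Q \o xi).
Proof.
rewrite !square_summableE => /bounded_mapP[M M0 QM] cxi.
apply: series_le_cvg (is_cvg_seriesZ (k := M) cxi) => n /=.
- exact: sqnorm_ge0.
- by rewrite mulr_ge0 ?sqnorm_ge0.
- exact: QM.
Qed.

Lemma is_cvg_vec_functional H (T : H -> H) (xi eta : nat -> H) :
  bounded_map T -> square_summable xi -> square_summable eta ->
  cvgn (series (fun n => (dot (T (xi n)) (eta n) : R[i]^o))).
Proof.
move=> bT /(square_summable_map bT); rewrite !square_summableE => cxi ceta.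
have := is_cvg_seriesD cxi ceta => /cvg_series_complex; apply=> n.
  exact: normr_Re_dot.
exact: normr_Im_dot.
Qed.

(** Boundedness is what makes the two series converge, so that their limits
can be added. *)
Lemma vec_functionalD H (S T : H -> H) (xi eta : nat -> H) :
  bounded_map S -> bounded_map T ->
  square_summable xi -> square_summable eta ->
  vec_functional xi eta (S + T) =
  vec_functional xi eta S + vec_functional xi eta T.
Proof.
move=> bS bT sxi seta; rewrite /vec_functional.
have cS := is_cvg_vec_functional bS sxi seta.
have cT := is_cvg_vec_functional bT sxi seta.
have <- := limD cS cT; congr (limn _); apply/funext => n.
apply: etrans (big_split _ _ _ _ _); apply: eq_bigr => i _.
exact: dotDl.
Qed.

(** Sequences concentrated at 0 turn a sigma-weak functional into a single
matrix coefficient; this is how sigma-weak limits are seen to be unique. *)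
Lemma vec_functional_test H (T : H -> H) (u v : H) :
  vec_functional (fun n => if n == 0%N then u else 0)
    (fun n => if n == 0%N then v else 0) T = dot (T u) v.
Proof.
rewrite /vec_functional; apply: cvg_lim; first exact: norm_hausdorff.
rewrite -(cvg_shiftn 1); apply: cvg_near_cst; near=> n.
rewrite /series /= addn1 big_nat_recl//= big1 ?addr0// => i _.
by rewrite dot0r.
Unshelve. all: by end_near. Qed.

Lemma square_summable_test H (u : H) :
  square_summable (fun n => if n == 0%N then u else 0).
Proof.
rewrite square_summableE; apply/cvg_ex; exists (sqnorm u).
rewrite -(cvg_shiftn 1); apply: cvg_near_cst; near=> n.
rewrite /series /= addn1 big_nat_recl//= big1 ?addr0// => i _.
exact: sqnorm0.
Unshelve. all: by end_near. Qed.

Lemma sweak_unique H (F : set_system (H -> H)) (S T : H -> H) :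
  ProperFilter F -> sweak_cvg F S -> sweak_cvg F T -> S = T.
Proof.
move=> FF FS FT; apply/funext => u; apply: dot_inj => v.
rewrite -!vec_functional_test.
apply: (@cvg_unique R[i]^o) (FS _ _ _ _) (FT _ _ _ _);
  [exact: norm_hausdorff|..]; exact: square_summable_test.
Qed.

Lemma cvg_eq_on (U : Type) (V : topologicalType) (F : set_system U) (M : set U)
    (f g : U -> V) (l : V) : Filter F -> F M -> (forall S, M S -> f S = g S) ->
  f @ F --> l -> g @ F --> l.
Proof.
move=> FF FM fg; apply: cvg_trans; apply: near_eq_cvg.
exact: filterS FM.
Qed.

(** Composing with fixed maps on both sides just moves them onto the test
sequences: P passes to the second one as its adjoint P'. *)
Lemma normal_sandwich H K (P : K -> H) (P' Q : H -> K) M :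
  (forall u v, dot (P u) v = dot u (P' v)) ->
  bounded_map P' -> bounded_map Q ->
  normal_on M (fun T => P \o T \o Q).
Proof.
move=> PP' bP' bQ F FF FM T MT FT xi eta sxi seta.
have E S : vec_functional xi eta (P \o S \o Q) =
    vec_functional (Q \o xi) (P' \o eta) S.
  by rewrite /vec_functional; under eq_fun do rewrite /= PP'.
rewrite E; apply: (cvg_eq_on (M := M)) FM _ (FT _ _ (square_summable_map bQ sxi)
  (square_summable_map bP' seta)) => S _.
by rewrite -E.
Qed.

Lemma normal_id H (M : set (H -> H)) : normal_on M id.
Proof. by move=> F FF FM T MT FT; exact: FT. Qed.

Lemma normal_comp H K L (M : set (H -> H)) (N : set (K -> K))
    (phi : (H -> H) -> (K -> K)) (psi : (K -> K) -> (L -> L)) :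
  (forall T, M T -> N (phi T)) -> normal_on M phi -> normal_on N psi ->
  normal_on M (psi \o phi).
Proof.
move=> MN nphi npsi F FF FM T MT FT.
apply: (npsi (phi @ F)); [|exact: MN|exact: nphi].
by change (F (phi @^-1` N)); exact: filterS FM.
Qed.

Lemma normal0 H K (M : set (H -> H)) : normal_on M (fun=> 0 : K -> K).
Proof. by move=> F FF FM T MT FT xi eta _ _; exact: cvg_cst. Qed.

Lemma normalD H K (M : set (H -> H)) (phi psi : (H -> H) -> (K -> K)) :
  (forall T, M T -> bounded_map (phi T)) ->
  (forall T, M T -> bounded_map (psi T)) ->
  normal_on M phi -> normal_on M psi ->
  normal_on M (fun T => phi T + psi T).
Proof.
move=> bphi bpsi nphi npsi F FF FM T MT FT xi eta sxi seta.
have -> := vec_functionalD (bphi T MT) (bpsi T MT) sxi seta.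
apply: (@cvg_eq_on _ _ F M
  ((vec_functional xi eta \o phi) \+ (vec_functional xi eta \o psi))
  (fun S => vec_functional xi eta (phi S + psi S)) _ _ FM) => [S MS|].
  exact: esym (vec_functionalD (bphi S MS) (bpsi S MS) sxi seta).
apply: cvgD; [exact: (nphi F FF FM T MT FT)|exact: (npsi F FF FM T MT FT)].
Qed.

Lemma normal_sum H K (M : set (H -> H)) (I : Type) (s : seq I)
    (phi : I -> (H -> H) -> (K -> K)) :
  (forall i T, M T -> bounded_map (phi i T)) ->
  (forall i, normal_on M (phi i)) ->
  normal_on M (fun T => \sum_(i <- s) phi i T).
Proof.
move=> bphi nphi; elim: s => [|i s IHs].
  by under eq_fun do rewrite big_nil; exact: normal0.
under eq_fun do rewrite big_cons.
apply: (normalD (bphi i) _ (nphi i) IHs) => T MT.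
rewrite (_ : (\sum_(_ <- _) _) = fun u => \sum_(j <- s) phi j T u).
  by apply: bounded_map_sum => j; exact: bphi.
by apply/funext => u; rewrite fct_sumE.
Qed.

(** By uniqueness of sigma-weak limits.  All the von Neumann algebras below are
cut out by such equations. *)
Lemma closed_equalizer H K (M : set (H -> H)) (phi psi : (H -> H) -> (K -> K)) :
  sweak_closed M -> normal_on M phi -> normal_on M psi ->
  sweak_closed [set T | M T /\ phi T = psi T].
Proof.
move=> cM nphi npsi F FF FE T bT FT.
have FM : F M by apply: filterS FE => S [].
have MT := cM F FF FM T bT FT; split=> //.
apply: (@sweak_unique _ (phi @ F)); first exact: nphi.
move=> xi eta sxi seta.
apply: (@cvg_eq_on _ _ F _ (fun S => vec_functional xi eta (psi S))
  (fun S => vec_functional xi eta (phi S)) _ _ FE) => [S [_ /= ->] //|].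
exact: (npsi F FF FM T MT FT).
Qed.

End SigmaWeak.

(** * Operators as matrices over an algebra *)
Section VonNeumann.
Variable R : realType.
Implicit Types H K : hilbertType R.

Lemma star_sum H (M : set (H -> H)) (I : Type) (s : seq I) (P : pred I)
    (F : I -> H -> H) :
  star_subalgebra M -> (forall i, P i -> M (F i)) ->
  M (\sum_(i <- s | P i) F i).
Proof.
by move=> sM MF; apply: big_ind => // [|S T]; [exact: star0|exact: starD].
Qed.

Lemma linear_mem H (M : set (H -> H)) T :
  star_subalgebra M -> M T -> linear_map T.
Proof. by move=> sM MT; have [] := star_bounded sM MT. Qed.

Lemma bounded_mem H (M : set (H -> H)) T :
  star_subalgebra M -> M T -> bounded_map T.
Proof. by move=> sM MT; have /bounded_opE[] := star_bounded sM MT. Qed.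

Lemma adjoint_sym H (S T : H -> H) : is_adjoint S T -> is_adjoint T S.
Proof. by move=> ST u v; rewrite dotC -ST -dotC. Qed.

Lemma adjoint_comp H (S S' T T' : H -> H) :
  is_adjoint S S' -> is_adjoint T T' -> is_adjoint (S \o T) (T' \o S').
Proof. by move=> SS TT u v; rewrite /= SS TT. Qed.

Lemma adjoint_unique H (S T T' : H -> H) :
  is_adjoint S T -> is_adjoint S T' -> T = T'.
Proof.
move=> /adjoint_sym ST /adjoint_sym ST'; apply/funext => u; apply: dot_inj => v.
by rewrite ST ST'.
Qed.

Lemma adjoint0 H : is_adjoint (0 : H -> H) 0.
Proof. by move=> u v; rewrite dot0l dot0r. Qed.

End VonNeumann.

Section Blocks.
Variables (R : realType) (X : finType) (H : hilbertType R).
Implicit Types (x y z : X) (h : H) (T S : {ffun X -> H} -> {ffun X -> H}).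
Implicit Types (xi eta : {ffun X -> H}).

Definition coord_in y h : {ffun X -> H} := [ffun z => if z == y then h else 0].

Lemma linear_coord_in y : linear_map (coord_in y).
Proof.
move=> a u v; apply/ffunP => z; rewrite !ffunE; case: ifP => // _.
by rewrite scaler0 addr0.
Qed.

Lemma bounded_coord_in y : bounded_map (coord_in y).
Proof.
apply: bounded_map_ffun => z; apply: bounded_map_if.
by exists 1 => u; rewrite mul1r.
Qed.

Lemma dot_coord_in xi x h : dot (xi x) h = dot xi (coord_in x h).
Proof.
rewrite [RHS]/dot /= (bigD1 x)//= ffunE eqxx big1 ?addr0// => z zx.
by rewrite ffunE (negbTE zx) dot0r.
Qed.

Lemma coord_in_sum xi : xi = \sum_y coord_in y (xi y).
Proof.
apply/ffunP => x; rewrite sum_ffunE (bigD1 x)//= ffunE eqxx big1 ?addr0// => y yx.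
by rewrite ffunE eq_sym (negbTE yx).
Qed.

Lemma entryE T xi x : linear_map T -> T xi x = \sum_y entry T x y (xi y).
Proof.
by move=> lT; rewrite {1}(coord_in_sum xi) (linear_map_sum _ _ lT) sum_ffunE.
Qed.

Lemma entry_linear T x y : linear_map T -> linear_map (entry T x y).
Proof.
move=> lT a u v; rewrite /entry.
by rewrite -!/(coord_in _ _) linear_coord_in lT !ffunE.
Qed.

Lemma entry_bounded T x y : bounded_map T -> bounded_map (entry T x y).
Proof.
move=> bT; exact: (@bounded_map_comp _ _ _ _ (fun xi : {ffun X -> H} => xi x)
  (fun h => T (coord_in y h)) (bounded_coord x)
  (bounded_map_comp bT (bounded_coord_in y))).
Qed.

Lemma entry_comp S T x y : linear_map S ->
  entry (S \o T) x y = \sum_z (entry S x z \o entry T z y).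
Proof. by move=> lS; apply/funext => h; rewrite fct_sumE -entryE. Qed.

Lemma entry_adjoint S T x y :
  is_adjoint S T -> is_adjoint (entry S x y) (entry T y x).
Proof.
move=> ST u v; rewrite dot_coord_in -!/(coord_in _ _).
by rewrite ST dotC [RHS]dotC dot_coord_in.
Qed.

Lemma normal_entry M x y : normal_on M (fun T => entry T x y).
Proof.
apply: (@normal_sandwich _ _ _ (fun xi => xi x) (coord_in x)).
- by move=> u v; rewrite dot_coord_in.
- exact: bounded_coord_in.
- exact: bounded_coord_in.
Qed.

Definition block_op (C : X -> X -> H -> H) : {ffun X -> H} -> {ffun X -> H} :=
  fun xi => [ffun x => \sum_y C x y (xi y)].

Lemma block_op_linear C : (forall x y, linear_map (C x y)) -> linear_map (block_op C).
Proof.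
move=> lC a u v; apply/ffunP => x; rewrite !ffunE scaler_sumr -big_split /=.
by apply: eq_bigr => y _; rewrite !ffunE lC.
Qed.

Lemma entry_block_op C x y :
  (forall x y, linear_map (C x y)) -> entry (block_op C) x y = C x y.
Proof.
move=> lC; apply/funext => h; rewrite /entry ffunE (bigD1 y)//= ffunE eqxx.
by rewrite big1 ?addr0// => z zy; rewrite ffunE (negbTE zy) (linear_map0 (lC _ _)).
Qed.

Lemma block_bounded T : linear_map T ->
  (forall x y, bounded_map (entry T x y)) -> bounded_op T.
Proof.
move=> lT bT; apply/bounded_opE; split => //.
rewrite (_ : T = fun xi => [ffun x => \sum_y entry T x y (xi y)]); last first.
  by apply/funext => xi; apply/ffunP => x; rewrite ffunE entryE.
apply: bounded_map_ffun => x; apply: bounded_map_sum => y.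
exact: bounded_map_comp (bT x y) (bounded_coord y).
Qed.

Lemma is_adjoint_block S T : linear_map S -> linear_map T ->
  (forall x y, is_adjoint (entry S x y) (entry T y x)) -> is_adjoint S T.
Proof.
move=> lS lT ST u v; rewrite /dot /=.
under eq_bigr do rewrite entryE// dot_suml.
under [RHS]eq_bigr do rewrite entryE// dot_sumr.
rewrite exchange_big; apply: eq_bigr => x _; apply: eq_bigr => y _.
exact: ST.
Qed.

End Blocks.

Section StarFamilies.
Variables (R : realType) (X : finType) (H : hilbertType R).
Implicit Types (x y z : X) (h : H) (e : rel X).

(** What is needed of a family of spaces of operators A x y for the matrices
with (x, y) entry in A x y to form a von Neumann algebra.  Letting the space
depend on the position treats at once the full matrix algebra, block diagonal
matrices and corners. *)
Record star_family (A : X -> X -> set (H -> H)) : Prop := StarFamily {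
  fam_bounded : forall x y, A x y `<=` @bounded_op R H ;
  fam0 : forall x y, A x y 0 ;
  famD : forall x y S T, A x y S -> A x y T -> A x y (S + T) ;
  famZ : forall x y a T, A x y T -> A x y (a *: T) ;
  famM : forall x y z S T, A x y S -> A y z T -> A x z (S \o T) ;
  fam_adj : forall x y T, A x y T -> exists2 S, A y x S & is_adjoint T S ;
  fam_closed : forall x y, sweak_closed (A x y)
}.

Definition block (A : X -> X -> set (H -> H)) : set ({ffun X -> H} -> {ffun X -> H}) :=
  [set T | linear_map T /\ forall x y, A x y (entry T x y)].

(** Algebraic closure is the usual matrix calculus; sigma-weak closure follows
because taking an entry is normal. *)
Lemma block_vn A : star_family A -> vn_subalgebra (block A).
Proof.
move=> fA; have AE x y T : A x y T -> linear_map T /\ bounded_map T.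
  by move=> /(fam_bounded fA)/bounded_opE.
split; first split.
- move=> T [lT AT]; apply: block_bounded => // x y.
  by have [] := AE _ _ _ (AT x y).
- split=> [a u v|x y]; first by rewrite scaler0 addr0.
  rewrite (_ : entry _ _ _ = 0); first exact: fam0.
  by apply/funext => h; rewrite /entry ffunE.
- move=> S T [lS AS] [lT AT]; split=> [a u v|x y].
    by rewrite !fctE lS lT scalerDr addrACA.
  rewrite (_ : entry _ _ _ = entry S x y + entry T x y); first exact: famD.
  by apply/funext => h; rewrite /entry !fctE ffunE.
- move=> c T [lT AT]; split=> [a u v|x y].
    by rewrite !fctE lT scalerDr !scalerA mulrC.
  rewrite (_ : entry _ _ _ = c *: entry T x y); first exact: famZ.
  by apply/funext => h; rewrite /entry !fctE ffunE.
- move=> S T [lS AS] [lT AT]; split=> [a u v|x y]; first by rewrite /= lT lS.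
  rewrite entry_comp//; apply: big_ind => [|S' T'|z _].
  + exact: fam0.
  + exact: famD.
  + exact: famM (AS _ _) (AT _ _).
- move=> T [lT AT].
  have /(_ _)/cid2-/all_sig2[C' AC' TC'] (xy : X * X) :
      exists2 S, A xy.1 xy.2 S & is_adjoint (entry T xy.2 xy.1) S.
    exact: fam_adj.
  pose C x y := C' (x, y).
  have lC x y : linear_map (C x y) by have [] := AE _ _ _ (AC' (x, y)).
  have lB := block_op_linear lC.
  exists (block_op C).
    by split=> // x y; rewrite entry_block_op//; exact: (AC' (x, y)).
  by apply: is_adjoint_block => // x y; rewrite entry_block_op//; exact: (TC' (y, x)).
move=> F FF FA T /bounded_opE[lT bT] FT; split=> // x y.
have FF' : ProperFilter ((fun T => entry T x y) @ F) by exact: fmap_proper_filter.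
apply: (fam_closed fA FF').
- change (F ((fun S => entry S x y) @^-1` A x y)).
  by apply: filterS FA => S [_ AS]; exact: AS.
- by apply/bounded_opE; split; [exact: entry_linear|exact: entry_bounded].
- exact: (@normal_entry _ _ _ setT x y F FF filterT T I FT).
Qed.

Lemma star_family_const A : vn_subalgebra A -> star_family (fun _ _ => A).
Proof.
move=> [sA cA]; split=> //.
- by move=> _ _; exact: star_bounded sA.
- by move=> _ _; exact: star0 sA.
- by move=> _ _; exact: starD sA.
- by move=> _ _; exact: starZ sA.
- by move=> _ _ _; exact: starM sA.
- by move=> _ _; exact: star_adj sA.
Qed.

(** Transitivity gives stability under products, symmetry under adjoints: the
matrices supported on an equivalence relation form an algebra. *)
Lemma star_family_restrict (e : rel X) A : symmetric e -> transitive e ->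
  star_family A -> star_family (fun x y => [set T | A x y T /\ (~~ e x y -> T = 0)]).
Proof.
move=> esym etr fA; split.
- by move=> x y T [/(fam_bounded fA)].
- by move=> x y; split=> //; exact: fam0.
- move=> x y S T [AS eS] [AT eT]; split=> [|exy]; first exact: famD.
  by rewrite eS// eT// addr0.
- move=> x y a T [AT eT]; split=> [|exy]; first exact: famZ.
  by rewrite eT// scaler0.
- move=> x y z S T [AS eS] [AT eT]; split=> [|exz]; first exact: famM AS AT.
  have [exy|/eS -> //] := boolP (e x y); apply/funext => h /=.
  have eyz : ~~ e y z by apply: contra exz; exact: etr.
  have /bounded_opE[lS _] := fam_bounded fA AS.
  by rewrite (eT eyz); exact: linear_map0 lS.
- move=> x y T [AT eT]; have [S AS TS] := fam_adj fA AT.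
  exists S => //; split=> //; rewrite esym => /eT T0.
  by rewrite T0 in TS; apply: (adjoint_unique TS); exact: adjoint0.
- move=> x y; have [exy|exy] := boolP (e x y).
    rewrite (_ : [set T | _] = A x y); first exact: fam_closed.
    by apply/seteqP; split=> [T []//|T AT]; split.
  rewrite (_ : [set T | _] = [set T | A x y T /\ id T = (fun=> 0) T]).
    by apply: closed_equalizer; [exact: fam_closed|exact: normal_id|exact: normal0].
  apply/seteqP; split=> [T [AT eT]|T [AT /= T0]]; split=> //.
  exact: eT.
Qed.

(** The family p x A p y.  Compressing on both sides keeps it stable under
products and adjoints for any self-adjoint p x. *)
Lemma star_family_corner (A : set (H -> H)) (p : X -> H -> H) :
  vn_subalgebra A -> (forall x, bounded_op (p x)) ->
  (forall x, is_adjoint (p x) (p x)) ->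
  star_family (fun x y => [set T | (A T /\ p x \o T = T) /\ T \o p y = T]).
Proof.
move=> [sA cA] bp adjp.
have lp x : linear_map (p x) by have [] := bp x.
have bmp x : bounded_map (p x) by have /bounded_opE[] := bp x.
split.
- by move=> x y T [[/(star_bounded sA)]].
- move=> x y; split=> //; split; first exact: star0.
  by apply/funext => h; rewrite /= (linear_map0 (lp x)).
- move=> x y S T [[AS pS] Sp] [[AT pT] Tp]; split; last first.
    by apply/funext => h; rewrite /= -[in RHS]Sp -[in RHS]Tp.
  split; first exact: starD.
  by apply/funext => h; rewrite /= (linear_mapD _ _ (lp x)) -[in RHS]pS -[in RHS]pT.
- move=> x y a T [[AT pT] Tp]; split; last first.
    by apply/funext => h; rewrite /= -[in RHS]Tp.
  split; first exact: starZ.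
  by apply/funext => h; rewrite /= (linear_mapZ _ _ (lp x)) -[in RHS]pT.
- move=> x y z S T [[AS pS] Sp] [[AT pT] Tp]; split; last by rewrite -compA Tp.
  by split; [exact: starM|rewrite compA pS].
- move=> x y T [[AT pT] Tp]; have [S AS TS] := star_adj sA AT.
  exists S => //; split; last first.
    by apply: (adjoint_unique _ TS); rewrite -{1}pT; exact: adjoint_comp (adjp x) TS.
  split=> //; apply: (adjoint_unique _ TS); rewrite -{1}Tp.
  exact: adjoint_comp TS (adjp y).
- move=> x y; have bid : bounded_map (@id H) by exists 1 => u; rewrite mul1r.
  have npx : normal_on A (fun T => p x \o T \o id).
    exact: normal_sandwich (adjp x) (bmp x) bid.
  have c1 : sweak_closed [set T | A T /\ p x \o T = T].
    exact: (closed_equalizer cA npx (@normal_id _ _ A)).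
  have npy : normal_on [set T | A T /\ p x \o T = T] (fun T => id \o T \o p y).
    by apply: (@normal_sandwich _ _ _ id id (p y)).
  exact: (closed_equalizer c1 npy (@normal_id _ _ _)).
Qed.

End StarFamilies.

Section Tensor.
Variables (R : realType) (X : finType) (H : hilbertType R).

Lemma basis_vecE (x y : X) : basis_vec R x y = (y == x)%:R.
Proof. by rewrite ffunE. Qed.

Lemma munitE (x y z : X) (xi : l2 R X) : munit x y xi z = xi y * (z == x)%:R.
Proof. by rewrite ffunE basis_vecE. Qed.

Lemma tens_linear (a : H -> H) (w : l2 R X -> l2 R X) :
  linear_map a -> linear_map (tens a w).
Proof.
move=> la c u v; apply/ffunP => x; rewrite !ffunE scaler_sumr -big_split /=.
apply: eq_bigr => y _; rewrite !ffunE la scalerDr !scalerA; congr (_ *: _ + _).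
exact: mulrC.
Qed.

Lemma entry_tens (a : H -> H) (w : l2 R X -> l2 R X) x y : linear_map a ->
  entry (tens a w) x y = w (basis_vec R y) x *: a.
Proof.
move=> la; apply/funext => h; rewrite /entry ffunE (bigD1 y)//= ffunE eqxx.
rewrite big1 ?addr0// => z zy.
by rewrite ffunE (negbTE zy) (linear_map0 la) scaler0.
Qed.

Lemma tens_munitE (a : H -> H) (x y : X) xi z :
  tens a (munit x y) xi z = if z == x then a (xi y) else 0.
Proof.
rewrite ffunE (bigD1 y)//= munitE basis_vecE eqxx mul1r.
rewrite big1 ?addr0 => [|t ty]; first by case: eqP; rewrite ?scale1r ?scale0r.
by rewrite munitE basis_vecE eq_sym (negbTE ty) mul0r scale0r.
Qed.

Lemma sum_tens_munitE (C : X -> X -> H -> H) xi x :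
  (\sum_x \sum_y tens (C x y) (munit x y)) xi x = \sum_y C x y (xi y).
Proof.
rewrite fct_sumE sum_ffunE (bigD1 x)//= [X in _ + X]big1 ?addr0 => [|z zx].
  rewrite fct_sumE sum_ffunE; apply: eq_bigr => y _.
  by rewrite tens_munitE eqxx.
rewrite fct_sumE sum_ffunE big1// => y _.
by rewrite tens_munitE eq_sym (negbTE zx).
Qed.

Lemma sum_tens_entry (T : {ffun X -> H} -> {ffun X -> H}) : linear_map T ->
  \sum_x \sum_y tens (entry T x y) (munit x y) = T.
Proof.
move=> lT; apply/funext => xi; apply/ffunP => x.
by rewrite sum_tens_munitE entryE.
Qed.

Lemma vn_tensor_sub (e : rel X) (A : set (H -> H)) (N : set (l2 R X -> l2 R X)) :
  symmetric e -> transitive e -> vn_subalgebra A ->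
  (forall w x y, N w -> ~~ e x y -> w (basis_vec R y) x = 0) ->
  vn_tensor A N `<=` block (fun x y => [set T | A T /\ (~~ e x y -> T = 0)]).
Proof.
move=> esym etr vA Ne T; apply; split.
  by apply: block_vn; apply: star_family_restrict => //; exact: star_family_const.
move=> _ [a Aa [w Nw <-]]; have la := linear_mem vA.1 Aa.
split=> [|x y]; first exact: tens_linear.
rewrite entry_tens//; split=> [|exy]; first exact: starZ vA.1 _ _ Aa.
by rewrite (Ne _ _ _ Nw exy) scale0r.
Qed.

(** One inclusion holds since the matrices over A supported on e form a von
Neumann algebra, the other since such a matrix is the finite sum of its
entries tensored with matrix units. *)
Lemma vn_tensorE (e : rel X) (A : set (H -> H)) (N : set (l2 R X -> l2 R X)) :
  symmetric e -> transitive e -> vn_subalgebra A ->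
  (forall w x y, N w -> ~~ e x y -> w (basis_vec R y) x = 0) ->
  (forall x y, e x y -> N (munit x y)) ->
  vn_tensor A N = block (fun x y => [set T | A T /\ (~~ e x y -> T = 0)]).
Proof.
move=> esym etr vA Ne eN; apply/seteqP; split; first exact: vn_tensor_sub.
move=> T [lT AT] M [vM SM]; rewrite -(sum_tens_entry lT).
apply: star_sum vM.1 _ => x _; apply: star_sum vM.1 _ => y _.
have [AxyT exyT] := AT x y; have [exy|exy] := boolP (e x y).
  by apply: SM; exists (entry T x y) => //; exists (munit x y) => //; exact: eN.
rewrite exyT// (_ : tens _ _ = 0); first exact: star0 vM.1.
by apply/funext => xi; apply/ffunP => z; rewrite tens_munitE if_same ffunE.
Qed.

End Tensor.

(** * The Weyl algebra of a finite groupoid *)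
Section GroupoidLaws.
Variable G : finGroupoid.
Local Notation s := (@gsrc G).
Local Notation r := (@grng G).
Implicit Types x y z w : G.

Lemma gmulK x y : s x = r y -> gmul (gmul x y) (ginv y) = x.
Proof. by move=> xy; rewrite -gmulA ?grng_inv// gmulV -xy gmul1r. Qed.

Lemma gmulVK x y : s x = s y -> gmul (gmul x (ginv y)) y = x.
Proof. by move=> xy; rewrite -gmulA ?grng_inv ?gsrc_inv// gmulVl -xy gmul1r. Qed.

Lemma gmulKV x y : r x = r y -> gmul x (gmul (ginv x) y) = y.
Proof. by move=> xy; rewrite gmulA ?grng_inv ?gsrc_inv// gmulV xy gmul1l. Qed.

End GroupoidLaws.

Section Weyl.
Variables (R : realType) (G : finGroupoid).
Local Notation s := (@gsrc G).
Local Notation r := (@grng G).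
Local Notation C1 := (R[i]^o : hilbertType R).

(** Operators on the one-dimensional space are multiplications by T 1, so
adjoints exist without the Riesz representation theorem. *)
Lemma scalar_op_vn : vn_subalgebra (@bounded_op R C1).
Proof.
split; last by move=> F FF FM T bT.
split.
- by [].
- apply/bounded_opE; split; last exact: bounded_map0.
  by move=> a u v; rewrite scaler0 addr0.
- move=> S T /bounded_opE[lS bS] /bounded_opE[lT bT]; apply/bounded_opE.
  split; last exact: bounded_mapD.
  by move=> a u v; rewrite !fctE lS lT scalerDr addrACA.
- move=> k T /bounded_opE[lT bT]; apply/bounded_opE; split.
    by move=> a u v; rewrite !fctE lT scalerDr !scalerA mulrC.
  exact: bounded_mapZ.
- move=> S T /bounded_opE[lS bS] /bounded_opE[lT bT]; apply/bounded_opE.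
  split; last exact: bounded_map_comp.
  by move=> a u v; rewrite /= lT lS.
- move=> T /bounded_opE[lT bT].
  exists (fun h : C1 => ((T 1)^*)%C *: h).
    apply/bounded_opE; split.
      by move=> a u v; rewrite scalerDr !scalerA mulrC.
    by apply: bounded_mapZ; exists 1 => u; rewrite mul1r.
  move=> u v; have -> : T u = u *: T 1.
    by rewrite -(linear_mapZ _ _ lT); congr T; rewrite /GRing.scale /= mulr1.
  by rewrite dotZl dotZr conjcK /dot /= mulrCA.
Qed.

(** Commuting with the indicator of r^-1(u) for every u means preserving the
subspaces l^2(r^-1(u)). *)
Lemma weylE : weyl_algebra R G = block (H := C1) (fun x y =>
  [set T | bounded_op T /\ (~~ (r x == r y) -> T = 0)]).
Proof.
apply/seteqP; split=> T.
  move=> [/bounded_opE[lT bT] comm]; split=> // x y; split=> [|xy].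
    by apply/bounded_opE; split; [exact: entry_linear|exact: entry_bounded].
  apply/funext => h; rewrite /entry -/(coord_in y h).
  (* Test against the indicator of the class of x, which kills position y. *)
  have {}comm : T (mulop (chi R (r x) \o r) (coord_in y h)) x =
      mulop (chi R (r x) \o r) (T (coord_in y h)) x.
    have cT := comm (mulop (chi R (r x) \o r)) (ex_intro2 _ _ (chi R (r x)) I erefl).
    by rewrite -[mulop _ (T _)]/((mulop (chi R (r x) \o r) \o T) _) -cT.
  move: comm; rewrite [RHS]ffunE /chi /= eqxx mul1r => <-.
  rewrite (_ : mulop _ _ = 0) ?(linear_map0 lT) ?ffunE//.
  apply/ffunP => z; rewrite !ffunE /=; case: (eqVneq z y) => [->|]; last first.
    by rewrite mulr0.
  by rewrite eq_sym (negbTE xy) mul0r.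
move=> [lT bT]; split.
  by apply: block_bounded => // x y; have [/bounded_opE[]] := bT x y.
move=> _ [f _ <-]; apply/funext => xi; apply/ffunP => x /=.
rewrite entryE// [RHS]ffunE entryE// mulr_sumr; apply: eq_bigr => y _.
have [/bounded_opE[lxy _] xy0] := bT x y; rewrite ffunE.
have [/eqP xy|/xy0 ->] := boolP (r x == r y); last by rewrite mulr0.
by rewrite /= xy -[_ * _]/(f (r y) *: (xi y : C1)) (linear_mapZ _ _ lxy).
Qed.

Lemma weyl_vn : vn_subalgebra (weyl_algebra R G).
Proof.
rewrite weylE; apply: block_vn.
apply: (@star_family_restrict _ _ _ (fun x y => r x == r y)).
- by move=> x y; rewrite eq_sym.
- by move=> y x z /eqP -> /eqP ->.
- exact: star_family_const scalar_op_vn.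
Qed.

Lemma weyl_coeff w x y : weyl_algebra R G w -> ~~ (r x == r y) ->
  w (basis_vec R y) x = 0.
Proof.
rewrite weylE => -[_ /(_ x y)[_ w0]] /w0 /(congr1 (@^~ 1)).
rewrite /entry (_ : [ffun _ => _] = basis_vec R y)//.
by apply/ffunP => z; rewrite !ffunE; case: eqP.
Qed.

Lemma munit_weyl x y : r x == r y -> weyl_algebra R G (munit x y).
Proof.
move=> /eqP xy; split.
  apply/bounded_opE; split.
    move=> a u v; apply/ffunP => z; rewrite !ffunE /= /GRing.scale /=.
    by rewrite mulrDl mulrA.
  rewrite (_ : munit x y = fun xi => [ffun z => (z == x)%:R *: (xi y : C1)]).
    by apply: bounded_map_ffun => z; apply: bounded_mapZ; exact: bounded_coord.
  by apply/funext => xi; apply/ffunP => z; rewrite munitE ffunE mulrC.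
move=> _ [f _ <-]; apply/funext => xi; apply/ffunP => z.
rewrite /= munitE !ffunE /= -xy; case: (eqVneq z x) => [->|_].
  by rewrite [RHS]mulrA.
by rewrite mulr0 scaler0 mulr0.
Qed.

Lemma mulop_weyl f : weyl_algebra R G (mulop f).
Proof.
split; last first.
  move=> _ [g _ <-]; apply/funext => xi; apply/ffunP => x.
  by rewrite /= !ffunE mulrCA.
apply/bounded_opE; split.
  move=> a u v; apply/ffunP => x; rewrite !ffunE mulrDr; congr (_ + _).
  exact: mulrCA.
rewrite (_ : mulop f = fun xi => [ffun z => f z *: (xi z : C1)])//.
by apply: bounded_map_ffun => z; apply: bounded_mapZ; exact: bounded_coord.
Qed.

Lemma rho_weyl g : weyl_algebra R G (rho g).
Proof.
split; last first.
  move=> _ [f _ <-]; apply/funext => xi; apply/ffunP => x; rewrite /= !ffunE.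
  case: ifPn => [/eqP xg|_]; last by rewrite mulr0.
  by rewrite /= grng_mul.
apply/bounded_opE; split.
  move=> a u v; apply/ffunP => x; rewrite !ffunE; case: ifP => // _.
  by rewrite scaler0 addr0.
apply: bounded_map_ffun => x; apply: bounded_map_if; exact: bounded_coord.
Qed.

Lemma rho_in_algebra g : rho_algebra R G (rho g).
Proof.
exists (chi R g); rewrite (bigD1 g)//= /chi eqxx scale1r big1 ?addr0// => x xg.
by rewrite (negbTE xg) scale0r.
Qed.

(** rho(x^-1 y) moves the basis vector at y to the one at x, and chi_x discards
its other values. *)
Lemma munit_factor x y : r x == r y ->
  munit x y = mulop (chi R x) \o rho (gmul (ginv x) y) :> (l2 R G -> l2 R G).
Proof.
move=> /eqP xy; apply/funext => xi; apply/ffunP => z; rewrite munitE /= !ffunE.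
rewrite /chi; case: eqVneq => [->|_]; last by rewrite mul0r mulr0.
by rewrite grng_mul ?gsrc_inv// grng_inv eqxx gmulKV// mul1r mulr1.
Qed.

Lemma sum_munit (T : l2 R G -> l2 R G) : linear_map T ->
  T = \sum_x \sum_y T (basis_vec R y) x *: munit x y.
Proof.
move=> lT; apply/funext => xi; apply/ffunP => z.
have xiE : xi = \sum_y xi y *: basis_vec R y.
  rewrite {1}(coord_in_sum xi); apply: eq_bigr => y _; apply/ffunP => x.
  rewrite !ffunE /GRing.scale /=.
  by case: eqVneq => _; rewrite ?mulr1 ?mulr0.
rewrite fct_sumE sum_ffunE (bigD1 z)//= [X in _ + X]big1 ?addr0 => [|x xz].
  rewrite {1}xiE (linear_map_sum _ _ lT) fct_sumE !sum_ffunE.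
  apply: eq_bigr => y _; rewrite (linear_mapZ _ _ lT) !ffunE.
  by rewrite eqxx /= /GRing.scale /= mulr1 mulrC.
rewrite fct_sumE sum_ffunE big1// => y _; rewrite !ffunE.
by rewrite eq_sym (negbTE xz) /= !scaler0.
Qed.

Lemma weyl_generated :
  weyl_algebra R G = vn_generated (mult_algebra R G `|` rho_algebra R G).
Proof.
apply/seteqP; split=> T.
  move=> wT M [vM gM]; have [/bounded_opE[lT _] _] := wT.
  rewrite (sum_munit lT); apply: star_sum vM.1 _ => x _.
  apply: star_sum vM.1 _ => y _.
  have [xy|xy] := boolP (r x == r y); last first.
    by rewrite (weyl_coeff wT xy) scale0r; exact: star0 vM.1.
  apply: (starZ vM.1); rewrite munit_factor//; apply: (starM vM.1); apply: gM.
    by left; exists (chi R x).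
  by right; exact: rho_in_algebra.
apply; split; first exact: weyl_vn.
move=> _ [[f _ <-]|[c ->]]; first exact: mulop_weyl.
apply: star_sum weyl_vn.1 _ => x _.
by apply: (starZ weyl_vn.1); exact: rho_weyl.
Qed.

End Weyl.

(** * The homogeneous components of an action *)
Section Action.
Variables (R : realType) (G : finGroupoid) (H : hilbertType R).
Variables (A : set (H -> H)) (b : (gobj G -> R[i]) -> (H -> H)).
Variable delta : (H -> H) -> ({ffun G -> H} -> {ffun G -> H}).
Hypotheses (vA : vn_algebra A) (rep : unital_faithful_rep A b).
Hypothesis act : right_action A b delta.
Local Notation s := (@gsrc G).
Local Notation r := (@grng G).
Implicit Types (x y z w : G) (u v : gobj G) (a c : H -> H).

Let sA : star_subalgebra A := vA.1.1.
Local Notation deltaP := (action_hom act).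

Definition proj u : H -> H := b (chi R u).

Lemma proj_in u : A (proj u). Proof. exact: (rep_in rep). Qed.

Lemma proj_linear u : linear_map (proj u).
Proof. exact: linear_mem sA (proj_in u). Qed.

Lemma proj_adj u : is_adjoint (proj u) (proj u).
Proof.
have := rep_adj rep (chi R u); congr is_adjoint; congr b.
by apply/funext => v; rewrite /chi conjc_nat.
Qed.

Lemma rep0 : b (fun=> 0) = 0.
Proof.
have := repZ rep 0 (fun=> 0); rewrite scale0r => <-; congr b.
by apply/funext => u; rewrite mul0r.
Qed.

Lemma projM u v : proj u \o proj v = if u == v then proj u else 0.
Proof.
rewrite -(repM rep); case: eqP => [->|uv]; last rewrite -rep0; congr b.
  by apply/funext => t; rewrite /chi /=; case: eqP; rewrite ?mulr1 ?mulr0.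
apply/funext => t; rewrite /chi /=; case: eqP => [->|_]; last by rewrite mul0r.
by case: eqP => [/uv//|]; rewrite mulr0.
Qed.

Lemma e_biE xi x : e_bi b xi x = proj (r x) (xi x).
Proof.
have tE u : tens (proj u) (mulop (chi R u \o r)) xi x =
    if u == r x then proj u (xi x) else 0.
  rewrite ffunE (bigD1 x)//= big1 ?addr0 => [|y yx].
    by rewrite !ffunE eqxx mulr1 /chi /= eq_sym; case: eqP; rewrite ?scale1r ?scale0r.
  by rewrite !ffunE eq_sym (negbTE yx) mulr0 scale0r.
rewrite /e_bi fct_sumE sum_ffunE (bigD1 (r x))//= -/(proj _) tE eqxx big1 ?addr0// => u ux.
by rewrite -/(proj _) tE (negbTE ux).
Qed.

Lemma delta1 : delta idfun = e_bi b.
Proof.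
have := action_unit act (fun=> 1); rewrite (rep1 rep) => ->.
apply/funext => xi /=; congr (e_bi b _); apply/ffunP => x.
rewrite ffunE (bigD1 x)//= !ffunE eqxx mulr1 scale1r big1 ?addr0// => y yx.
by rewrite !ffunE eq_sym (negbTE yx) mulr0 scale0r.
Qed.

(** The homogeneous component delta_x of the action. *)
Definition translate x a : H -> H := entry (delta a) x x.

(** Elements of A tensor C(G) are diagonal matrices over A. *)
Lemma delta_block a : A a ->
  block (fun x y => [set T | A T /\ (~~ (x == y) -> T = 0)]) (delta a).
Proof.
move=> Aa; apply: vn_tensor_sub (hom_fun deltaP Aa).
- exact: eq_sym.
- by move=> x y z /eqP -> /eqP ->.
- exact: vA.1.
- by move=> _ x y [f _ <-] xy; rewrite !ffunE (negbTE xy) mulr0.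
Qed.

Lemma translate_in x a : A a -> A (translate x a).
Proof. by move=> /delta_block[_ /(_ x x)[]]. Qed.

Lemma delta_linear a : A a -> linear_map (delta a).
Proof. by move=> /delta_block[]. Qed.

Lemma translate_linear x a : A a -> linear_map (translate x a).
Proof. by move=> Aa; exact: linear_mem sA (translate_in x Aa). Qed.

Lemma deltaE a xi x : A a -> delta a xi x = translate x a (xi x).
Proof.
move=> Aa; have [ld da] := delta_block Aa.
rewrite entryE// (bigD1 x)//= big1 ?addr0// => y yx.
by have [_ ->] := da x y; rewrite // eq_sym.
Qed.

Lemma delta0 : delta 0 = 0.
Proof. by have := homZ deltaP 0 (star0 sA); rewrite !scale0r. Qed.

Lemma translateM x a c : A a -> A c ->
  translate x (a \o c) = translate x a \o translate x c.
Proof.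
move=> Aa Ac; apply/funext => h.
by rewrite /translate (homM deltaP)// /entry /= deltaE.
Qed.

Lemma translateZ x k a : A a -> translate x (k *: a) = k *: translate x a.
Proof.
move=> Aa; apply/funext => h.
by rewrite /translate (homZ deltaP)// /entry /= !fctE ffunE.
Qed.

(** The (x, y) coordinate of the coassociativity equation. *)
Lemma translate_translate x y a : A a ->
  translate x (translate y a) =
  if s x == r y then translate (gmul x y) a else 0.
Proof.
move=> Aa; apply/funext => h.
have : hom_tens_id delta (delta a) (coord_in y (coord_in x h)) y x =
    id_tens_comult (delta a) (coord_in y (coord_in x h)) y x.
  by rewrite (action_coassoc act Aa).
rewrite /hom_tens_id sum_tens_munitE sum_ffunE (bigD1 y)//= [X in _ + X]big1 ?addr0; last first.
  move=> z zy; have [_ /(_ y z)[_ ->]] := delta_block Aa; last by rewrite eq_sym.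
  by rewrite delta0 ffunE.
rewrite -/(translate y a) deltaE; last exact: translate_in.
have cE : coord_in y (coord_in x h) y x = h by rewrite !(ffunE, eqxx).
rewrite cE => ->; rewrite /id_tens_comult ffunE ffunE cE /comult.
case: ifP => _; last by rewrite big1// => z _; rewrite scale0r.
rewrite (bigD1 (gmul x y))//= /chi eqxx scale1r big1 ?addr0// => z zxy.
by rewrite eq_sym (negbTE zxy) scale0r.
Qed.

Lemma translate_proj x u : translate x (proj u) = if u == s x then proj (r x) else 0.
Proof.
apply/funext => h; rewrite /translate /entry (action_unit act) /= e_biE.
rewrite ffunE (bigD1 x)//= !ffunE eqxx mulr1 big1 ?addr0; last first.
  by move=> y yx; rewrite !ffunE eq_sym (negbTE yx) mulr0 scale0r.
rewrite /chi /= [s x == u]eq_sym; case: eqP => _; first by rewrite scale1r.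
by rewrite scale0r (linear_map0 (proj_linear _)).
Qed.

Lemma translate1 x : translate x idfun = proj (r x).
Proof.
apply/funext => h; rewrite /translate /entry delta1 e_biE.
by rewrite ffunE eqxx.
Qed.

Lemma proj_comp_translate x a : A a -> proj (r x) \o translate x a = translate x a.
Proof. by move=> Aa; rewrite -translate1 -translateM//; exact: vA.2. Qed.

(** Both sides have the same image under delta, because delta_x delta_{id u} is
delta_x if u = s x and 0 otherwise. *)
Lemma sum_translate_id a : A a -> \sum_u translate (gid u) a = a.
Proof.
move=> Aa; have As : A (\sum_u translate (gid u) a).
  by apply: star_sum => // u _; exact: translate_in.
apply: (action_inj act); rewrite ?inE//.
have dD : delta (\sum_u translate (gid u) a) = \sum_u delta (translate (gid u) a).
  suff [] : A (\sum_u translate (gid u) a) /\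
    delta (\sum_u translate (gid u) a) = \sum_u delta (translate (gid u) a) by [].
  elim/big_ind2: _ => [|S S' T T' [AS <-] [AT <-]|u _].
  - by split; [exact: star0|exact: delta0].
  - by split; [exact: starD|exact: (homD deltaP)].
  - by split; [exact: translate_in|].
rewrite dD; apply/funext => xi; apply/ffunP => x.
rewrite fct_sumE sum_ffunE (bigD1 (s x))//= big1 ?addr0 => [|u ux].
  rewrite !deltaE//; last exact: translate_in.
  by rewrite translate_translate// grng_id eqxx gmul1r.
rewrite deltaE; last exact: translate_in.
by rewrite translate_translate// grng_id eq_sym (negbTE ux).
Qed.

Lemma translate_comp_proj x a : A a -> translate x a \o proj (r x) = translate x a.
Proof. by move=> Aa; rewrite -translate1 -translateM//; exact: vA.2. Qed.

(** Only the u-component of a = sum_v delta_{id v}(a) survives; together with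
[comp_proj] this makes the projections central. *)
Lemma proj_comp u a : A a -> proj u \o a = translate (gid u) a.
Proof.
move=> Aa; apply/funext => h /=; rewrite -{1}(sum_translate_id Aa) fct_sumE.
rewrite (linear_map_sum _ _ (proj_linear u)) (bigD1 u)//= big1 ?addr0 => [|v vu].
  by rewrite -[RHS](congr1 (@^~ h) (proj_comp_translate (gid u) Aa)) /= grng_id.
rewrite -(proj_comp_translate (gid v) Aa) grng_id /=.
by rewrite -[LHS]/((proj u \o proj v) _) projM eq_sym (negbTE vu).
Qed.

Lemma comp_proj u a : A a -> a \o proj u = translate (gid u) a.
Proof.
move=> Aa; apply/funext => h /=; rewrite -{1}(sum_translate_id Aa) fct_sumE.
rewrite (bigD1 u)//= big1 ?addr0 => [|v vu].
  by rewrite -[RHS](congr1 (@^~ h) (translate_comp_proj (gid u) Aa)) /= grng_id.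
rewrite -(translate_comp_proj (gid v) Aa) grng_id /=.
rewrite -[X in translate _ _ X]/((proj v \o proj u) _) projM (negbTE vu).
by rewrite (linear_map0 (translate_linear _ Aa)).
Qed.

(** * The homomorphism extending the dual coaction *)
(** The matrix form of the corner delta(1)(A tensor W)delta(1); that entries
with r x <> r y vanish is a consequence, [corner_entry0]. *)
Definition corner_algebra : set ({ffun G -> H} -> {ffun G -> H}) :=
  block (fun x y : G =>
    [set T | (A T /\ proj (r x) \o T = T) /\ T \o proj (r y) = T]).
Local Notation C := corner_algebra.
Local Notation K := {ffun G -> {ffun G -> H}}.

Lemma corner_algebra_vn : vn_subalgebra C.
Proof.
apply: block_vn; apply: star_family_corner; first exact: vA.1.
- by move=> x; exact: star_bounded sA _ (proj_in _).
- by move=> x; exact: proj_adj.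
Qed.

Let sC : star_subalgebra C := corner_algebra_vn.1.

Lemma corner_entry T x y : C T -> A (entry T x y).
Proof. by move=> [_ /(_ x y)[[]]]. Qed.

Lemma corner_entryl T x y : C T -> proj (r x) \o entry T x y = entry T x y.
Proof. by move=> [_ /(_ x y)[[]]]. Qed.

(** Centrality lets the two orthogonal projections meet on the same side. *)
Lemma corner_entry0 T x y : C T -> r x != r y -> entry T x y = 0.
Proof.
move=> [_ /(_ x y)[[AT pT] Tp]] xy.
have <- : proj (r x) \o (proj (r y) \o entry T x y) = entry T x y.
  by rewrite (proj_comp _ AT) -(comp_proj _ AT) Tp pT.
by rewrite compA projM (negbTE xy).
Qed.

(** The coordinates (w y, y) of a vector, as a function of w; in these
coordinates the partial isometry I implementing the dual coaction disappears. *)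
Definition slice y (xi : K) : {ffun G -> H} :=
  [ffun w => if s w == r y then xi y (gmul w y) else 0].

(** The adjoint of [slice]. *)
Definition unslice y (zeta : {ffun G -> H}) : K :=
  [ffun y' => [ffun x =>
    if (y' == y) && (s x == s y) then zeta (gmul x (ginv y)) else 0]].

Lemma slice_linear y : linear_map (slice y).
Proof.
move=> k u v; apply/ffunP => w; rewrite !ffunE; case: ifP => // _.
by rewrite scaler0 addr0.
Qed.

Lemma unslice_linear y : linear_map (unslice y).
Proof.
move=> k u v; apply/ffunP => y'; apply/ffunP => x; rewrite !ffunE.
by case: ifP => // _; rewrite scaler0 addr0.
Qed.

Lemma slice_bounded y : bounded_map (slice y).
Proof.
apply: bounded_map_ffun => w; apply: bounded_map_if.
exact: bounded_map_comp (bounded_coord (gmul w y)) (bounded_coord y).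
Qed.

Lemma unslice_bounded y : bounded_map (unslice y).
Proof.
apply: bounded_map_ffun => y'; apply: bounded_map_ffun => x.
by apply: bounded_map_if; exact: bounded_coord.
Qed.

(** Substitute x = w y. *)
Lemma dot_unslice y zeta xi : dot (unslice y zeta) xi = dot zeta (slice y xi).
Proof.
rewrite {1}/dot /= (bigD1 y)//= [X in _ + X]big1 ?addr0 => [|y' yy']; last first.
  rewrite (_ : unslice y zeta y' = 0) ?dot0l//.
  by apply/ffunP => x; rewrite !ffunE (negbTE yy').
rewrite {1}/dot [RHS]/dot /=.
transitivity (\sum_(x | s x == s y) dot (zeta (gmul x (ginv y))) (xi y x)).
  rewrite [RHS]big_mkcond; apply: eq_bigr => x _; rewrite !ffunE eqxx /=.
  by case: ifP => _; rewrite ?dot0l.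
transitivity (\sum_(w | s w == r y) dot (zeta w) (xi y (gmul w y))); last first.
  rewrite big_mkcond; apply: eq_bigr => w _; rewrite !ffunE.
  by case: ifP => _; rewrite ?dot0r.
rewrite (reindex_onto (fun w => gmul w y) (fun x => gmul x (ginv y))) /=; last first.
  by move=> x /eqP; exact: gmulVK.
apply: eq_big => [w|w /andP[_ /eqP ->]//].
apply/andP/eqP => [[/eqP sw /eqP <-]|wy]; last by rewrite gsrc_mul// gmulK.
by rewrite gsrc_mul ?grng_inv// gsrc_inv.
Qed.

Lemma slice_unslice y z zeta w :
  slice y (unslice z zeta) w = if (y == z) && (s w == r y) then zeta w else 0.
Proof.
rewrite ffunE; case: ifP => [/eqP wy|_]; last by rewrite andbF.
rewrite !ffunE andbT; case: eqP => //= <-.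
by rewrite gsrc_mul// eqxx gmulK.
Qed.

(** (delta tensor i)(T) read in the coordinates (w y, y). *)
Definition dual_hom (T : {ffun G -> H} -> {ffun G -> H}) : K -> K :=
  \sum_y \sum_y' (unslice y \o delta (entry T y y') \o slice y').

Lemma dual_hom_sum T xi : dual_hom T xi =
  \sum_y unslice y (\sum_y' delta (entry T y y') (slice y' xi)).
Proof.
rewrite /dual_hom fct_sumE; apply: eq_bigr => y _.
rewrite fct_sumE (linear_map_sum _ _ (unslice_linear y)).
by apply: eq_bigr.
Qed.

Lemma dot_dual_hom T xi eta : dot (dual_hom T xi) eta =
  \sum_y \sum_y' dot (delta (entry T y y') (slice y' xi)) (slice y eta).
Proof.
rewrite dual_hom_sum dot_suml; apply: eq_bigr => y _.
by rewrite dot_unslice dot_suml.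
Qed.

Lemma delta_bounded a : A a -> bounded_map (delta a).
Proof.
move=> Aa; have [ld _] := delta_block Aa.
rewrite (_ : delta a = fun xi => [ffun x => translate x a (xi x)]).
  apply: bounded_map_ffun => x.
  exact: bounded_map_comp (bounded_mem sA (translate_in x Aa)) (bounded_coord x).
by apply/funext => xi; apply/ffunP => x; rewrite ffunE deltaE.
Qed.

Lemma dual_hom_bounded T : C T -> bounded_op (dual_hom T).
Proof.
move=> CT; apply/bounded_opE; split=> [k u v|].
  rewrite !dual_hom_sum scaler_sumr -big_split /=; apply: eq_bigr => y _.
  rewrite -(unslice_linear y) scaler_sumr -big_split /=; congr (unslice y _).
  apply: eq_bigr => y' _; rewrite slice_linear.
  by rewrite (delta_linear (corner_entry y y' CT)).
rewrite (_ : dual_hom T = fun xi =>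
    \sum_y \sum_y' unslice y (delta (entry T y y') (slice y' xi))).
  apply: bounded_map_sum => y; apply: bounded_map_sum => y'.
  apply: bounded_map_comp (unslice_bounded y) _.
  exact: bounded_map_comp (delta_bounded (corner_entry y y' CT)) (slice_bounded y').
apply/funext => xi; rewrite dual_hom_sum; apply: eq_bigr => y _.
by rewrite (linear_map_sum _ _ (unslice_linear y)).
Qed.

(** The cut-off s w = r y from [slice_unslice] costs nothing, since
delta_w(p_{r y}) is 0 unless s w = r y; multiplicativity rests on this. *)
Lemma slice_dual_hom T y xi : C T ->
  slice y (dual_hom T xi) = \sum_y' delta (entry T y y') (slice y' xi).
Proof.
move=> CT; apply/ffunP => w.
rewrite dual_hom_sum (linear_map_sum _ _ (slice_linear y)) sum_ffunE.
rewrite (bigD1 y)//= [X in _ + X]big1 ?addr0 => [|z zy]; last first.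
  by rewrite slice_unslice eq_sym (negbTE zy).
rewrite slice_unslice eqxx /=; case: ifPn => // wy.
rewrite sum_ffunE big1// => y' _; rewrite deltaE; last exact: corner_entry.
rewrite -corner_entryl// translateM; [|exact: proj_in|exact: corner_entry].
by rewrite translate_proj eq_sym (negbTE wy).
Qed.

Definition diag_in (xi : {ffun G -> H}) : K :=
  [ffun y => [ffun x => if x == y then xi y else 0]].

Definition diag_out (eta : K) : {ffun G -> H} := [ffun y => eta y y].

(** Keeps the coordinates (y, y), that is w = id in the coordinates
(w y, y). *)
Definition compress (T : K -> K) : {ffun G -> H} -> {ffun G -> H} :=
  diag_out \o T \o diag_in.

Lemma dot_diag_out eta xi : dot (diag_out eta) xi = dot eta (diag_in xi).
Proof.
rewrite {1}/dot [RHS]/dot /=; apply: eq_bigr => y _; rewrite !ffunE.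
rewrite dot_coord_in; by congr dot; apply/ffunP => x; rewrite !ffunE.
Qed.

Lemma diag_in_bounded : bounded_map diag_in.
Proof.
apply: bounded_map_ffun => y; apply: bounded_map_ffun => x.
by apply: bounded_map_if; exact: bounded_coord.
Qed.

Lemma diag_out_bounded : bounded_map diag_out.
Proof.
apply: bounded_map_ffun => y.
exact: bounded_map_comp (bounded_coord y) (bounded_coord y).
Qed.

Lemma compress_normal M : normal_on M compress.
Proof.
exact: normal_sandwich dot_diag_out diag_in_bounded diag_in_bounded.
Qed.

(** At w = id the operator delta_w(T_{y,y'}) is p_{r y} T_{y,y'}, which is
T_{y,y'} again. *)
Lemma dual_homK T : C T -> compress (dual_hom T) = T.
Proof.
move=> CT; have [lT _] := CT; apply/funext => xi; apply/ffunP => y.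
rewrite /compress /= ffunE.
have -> (eta : K) : eta y y = slice y eta (gid (r y)).
  by rewrite ffunE gsrc_id eqxx gmul1l.
rewrite slice_dual_hom// sum_ffunE entryE//; apply: eq_bigr => y' _.
rewrite deltaE; last exact: corner_entry.
rewrite -proj_comp ?corner_entryl//; last exact: corner_entry.
rewrite ffunE gsrc_id; case: eqP => [->|/eqP yy']; first by rewrite gmul1l !ffunE eqxx.
by rewrite corner_entry0.
Qed.

Lemma dual_homD S T : C S -> C T -> dual_hom (S + T) = dual_hom S + dual_hom T.
Proof.
move=> CS CT; apply/funext => xi; apply: dot_inj => eta.
rewrite -[(dual_hom S + _) xi]/(dual_hom S xi + dual_hom T xi) dotDl !dot_dual_hom -big_split; apply: eq_bigr => y _.
rewrite -big_split; apply: eq_bigr => y' _ /=.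
rewrite -dotDl (_ : entry (S + T) y y' = entry S y y' + entry T y y').
  by rewrite (homD deltaP)//; exact: corner_entry.
by apply/funext => h; rewrite /entry !fctE ffunE.
Qed.

Lemma dual_homZ k T : C T -> dual_hom (k *: T) = k *: dual_hom T.
Proof.
move=> CT; apply/funext => xi; apply: dot_inj => eta.
rewrite -[(k *: dual_hom T) xi]/(k *: dual_hom T xi) dotZl !dot_dual_hom mulr_sumr; apply: eq_bigr => y _.
rewrite mulr_sumr; apply: eq_bigr => y' _ /=.
rewrite -dotZl (_ : entry (k *: T) y y' = k *: entry T y y').
  by rewrite (homZ deltaP)//; exact: corner_entry.
by apply/funext => h; rewrite /entry !fctE ffunE.
Qed.

Lemma dual_hom0 : dual_hom 0 = 0.
Proof. by have := dual_homZ 0 (star0 sC); rewrite !scale0r. Qed.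

Lemma delta_sum (I : Type) (t : seq I) (F : I -> H -> H) :
  (forall i, A (F i)) -> delta (\sum_(i <- t) F i) = \sum_(i <- t) delta (F i).
Proof.
move=> AF; elim: t => [|i t IHt]; first by rewrite !big_nil delta0.
by rewrite !big_cons (homD deltaP) ?IHt//; exact: star_sum.
Qed.

(** By [slice_dual_hom] slices intertwine [dual_hom] with matrix
multiplication by the delta(T_{y,y'}). *)
Lemma dual_homM S T : C S -> C T -> dual_hom (S \o T) = dual_hom S \o dual_hom T.
Proof.
move=> CS CT; have [lS _] := CS; apply/funext => xi; apply: dot_inj => eta /=.
rewrite !dot_dual_hom; apply: eq_bigr => y _.
under [RHS]eq_bigr => y' _.
  rewrite slice_dual_hom// (linear_map_sum _ _ (delta_linear (corner_entry _ _ CS))).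
  rewrite dot_suml; over.
rewrite [RHS]exchange_big /=; apply: eq_bigr => z _.
rewrite (@entry_comp _ _ _ S T y z lS) delta_sum => [|y']; last first.
  by apply: (starM sA); exact: corner_entry.
rewrite fct_sumE dot_suml; apply: eq_bigr => y' _.
by rewrite (homM deltaP)//; exact: corner_entry.
Qed.

Lemma dual_hom_adj S T : C S -> C T ->
  is_adjoint S T -> is_adjoint (dual_hom S) (dual_hom T).
Proof.
move=> CS CT ST xi eta; rewrite dot_dual_hom [RHS]dotC dot_dual_hom.
rewrite exchange_big rmorph_sum; apply: eq_bigr => y _ /=.
rewrite rmorph_sum; apply: eq_bigr => y' _ /=; rewrite -dotC.
apply: (hom_adj deltaP); [exact: corner_entry..|].
exact: entry_adjoint.
Qed.

Lemma dual_hom_normal : normal_on C dual_hom.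
Proof.
have bW y y' T : C T ->
    bounded_map (unslice y \o delta (entry T y y') \o slice y').
  move=> CT; apply: bounded_map_comp (slice_bounded y').
  exact: bounded_map_comp (unslice_bounded y) (delta_bounded (corner_entry y y' CT)).
apply: normal_sum => [y T CT|y].
  rewrite (_ : (\sum_(_ <- _) _) = fun xi => \sum_y'
      (unslice y \o delta (entry T y y') \o slice y') xi).
    by apply: bounded_map_sum => y'; exact: bW.
  by apply/funext => xi; rewrite fct_sumE.
apply: normal_sum => [y' T|y']; first exact: bW.
have CA T : C T -> A (entry T y y') by exact: corner_entry.
have ndelta : normal_on C (delta \o (fun T => entry T y y')).
  exact: normal_comp CA (@normal_entry _ _ _ _ _ _) (action_normal act).
have nslice : normal_on setT (fun S => unslice y \o S \o slice y').
  exact: normal_sandwich (dot_unslice y) (slice_bounded y) (slice_bounded y').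
exact: (@normal_comp _ _ _ _ C setT _ _ (fun _ _ => I) ndelta nslice).
Qed.

(** For closure, compress a convergent filter in the image: its limit has a
compression in C, whose image must be the original limit because [dual_hom]
and [compress] are both normal. *)
Lemma dual_hom_image_vn : vn_subalgebra (dual_hom @` C).
Proof.
split; first split.
- by move=> _ [T CT <-]; exact: dual_hom_bounded.
- by exists 0; [exact: star0|exact: dual_hom0].
- move=> _ _ [S CS <-] [T CT <-].
  by exists (S + T); [exact: starD|exact: dual_homD].
- move=> k _ [T CT <-].
  by exists (k *: T); [exact: starZ|exact: dual_homZ].
- move=> _ _ [S CS <-] [T CT <-].
  by exists (S \o T); [exact: starM|exact: dual_homM].
- move=> _ [T CT <-]; have [S CS TS] := star_adj sC CT.
  by exists (dual_hom S); [exists S|exact: dual_hom_adj].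
move=> F FF FM T bT FT.
have FC : F (compress @^-1` C).
  by apply: filterS FM => _ [T' CT' <-]; rewrite /= dual_homK.
have FF' : ProperFilter (compress @ F) by exact: fmap_proper_filter.
have cFT : sweak_cvg (compress @ F) (compress T).
  exact: (@compress_normal setT F FF filterT T I FT).
have CT : C (compress T).
  apply: (corner_algebra_vn.2 _ FF' FC _ _ cFT).
    have [bl bb] := (bounded_opE T).1 bT; apply/bounded_opE; split.
    move=> k u v; apply/ffunP => y; rewrite /compress /= !ffunE.
    have -> : diag_in (k *: u + v) = k *: diag_in u + diag_in v.
      apply/ffunP => z; apply/ffunP => x; rewrite !ffunE; case: ifP => // _.
      by rewrite scaler0 addr0.
    by rewrite bl !ffunE.
  exact: bounded_map_comp diag_out_bounded (bounded_map_comp bb diag_in_bounded).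
exists (compress T) => //.
apply: (@sweak_unique _ _ F) FT => xi eta sxi seta.
have : sweak_cvg (dual_hom @ (compress @ F)) (dual_hom (compress T)).
  exact: (dual_hom_normal FF' FC CT cFT).
move=> /(_ xi eta sxi seta) dFT.
apply: (@cvg_eq_on _ _ F _ (fun S => vec_functional xi eta (dual_hom (compress S)))
  (vec_functional xi eta) _ _ FM) dFT => _ [S CS <-].
by rewrite dual_homK.
Qed.

(** * Agreement with the dual coaction on generators *)
Lemma dual_homE T xi x y : dual_hom T xi y x =
  if s x == s y then
    \sum_y' delta (entry T y y') (slice y' xi) (gmul x (ginv y)) else 0.
Proof.
rewrite dual_hom_sum !sum_ffunE (bigD1 y)//= [X in _ + X]big1 ?addr0 => [|z zy].
  rewrite !ffunE eqxx /=; case: ifP => // _.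
  by rewrite sum_ffunE.
by rewrite !ffunE eq_sym (negbTE zy).
Qed.

(** The generators of the crossed product and the multiplication operators all
have a single nonzero entry in each row; treating them uniformly makes
[dual_hom] explicit on each of them. *)
Definition monomial_op (k : pred G) (a : G -> H -> H) (sigma : G -> G) :
    {ffun G -> H} -> {ffun G -> H} :=
  fun xi => [ffun t => if k t then a t (xi (sigma t)) else 0].

Definition corner_monomial (k : pred G) (a : G -> H -> H) (sigma : G -> G) :=
  forall t, k t -> [/\ A (a t), proj (r t) \o a t = a t & r (sigma t) = r t].

Lemma entry_monomial k f sigma x y : corner_monomial k f sigma ->
  entry (monomial_op k f sigma) x y = if k x && (sigma x == y) then f x else 0.
Proof.
move=> kas; apply/funext => h; rewrite /entry !ffunE.
case: ifPn => // /kas[Aa _ _] /=; case: ifP => // _.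
exact: linear_map0 (linear_mem sA Aa).
Qed.

Lemma monomial_corner k f sigma :
  corner_monomial k f sigma -> C (monomial_op k f sigma).
Proof.
move=> kas; split=> [c u v|x y].
  apply/ffunP => t; rewrite !ffunE; case: ifPn => [/kas[Aa _ _]|_].
    exact: (linear_mem sA Aa).
  by rewrite scaler0 addr0.
rewrite entry_monomial//; case: ifPn => [/andP[/kas[Aa pa sx] /eqP <-]|_].
  by split=> //; rewrite sx comp_proj// -proj_comp.
split=> //; split; first exact: star0.
by apply/funext => h; exact: linear_map0 (proj_linear _).
Qed.

Lemma dual_hom_monomial k f sigma xi x y : corner_monomial k f sigma ->
  dual_hom (monomial_op k f sigma) xi y x =
  if (s x == s y) && k y then
    translate (gmul x (ginv y)) (f y) (xi (sigma y) (gmul (gmul x (ginv y)) (sigma y)))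
  else 0.
Proof.
move=> kas; rewrite dual_homE; case: ifPn => //= /eqP xy.
rewrite (bigD1 (sigma y))//= [X in _ + X]big1 ?addr0 => [|z zy]; last first.
  by rewrite entry_monomial// eq_sym (negbTE zy) andbF delta0 ffunE.
rewrite entry_monomial// eqxx andbT; case: ifPn => [/kas[Aa _ sy]|_]; last first.
  by rewrite delta0 ffunE.
rewrite deltaE// ffunE sy gsrc_mul ?grng_inv// gsrc_inv eqxx.
by [].
Qed.

Lemma tens_idE (K' : hilbertType R) (z : K' -> K') (xi : {ffun G -> K'}) y :
  tens z idfun xi y = z (xi y).
Proof.
rewrite ffunE (bigD1 y)//= basis_vecE eqxx scale1r big1 ?addr0// => t ty.
by rewrite basis_vecE eq_sym (negbTE ty) scale0r.
Qed.

Lemma dual_coactionE T (xi : K) x y : dual_coaction T xi y x =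
  if s x == s y then T (I23_adj xi (gmul y (ginv x))) x else 0.
Proof. by rewrite /dual_coaction /= ffunE ffunE tens_idE. Qed.

Lemma I23_adjE (xi : K) y x :
  I23_adj xi y x = if s y == r x then xi (gmul y x) x else 0.
Proof. by rewrite ffunE ffunE. Qed.

Lemma dual_coactionD (S T : {ffun G -> H} -> {ffun G -> H}) :
  dual_coaction (S + T) = dual_coaction S + dual_coaction T.
Proof.
apply/funext => xi; apply/ffunP => y; apply/ffunP => x.
have addE (u v : K) : (u + v) y x = u y x + v y x by rewrite 2!ffunE.
apply: etrans (esym (addE (dual_coaction S xi) (dual_coaction T xi))).
rewrite !dual_coactionE; case: ifP => _; last by rewrite addr0.
by rewrite !fctE ffunE.
Qed.

Lemma dual_coactionZ k (T : {ffun G -> H} -> {ffun G -> H}) :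
  dual_coaction (k *: T) = k *: dual_coaction T.
Proof.
apply/funext => xi; apply/ffunP => y; apply/ffunP => x.
have scaleE (u : K) : (k *: u) y x = k *: u y x by rewrite 2!ffunE.
apply: etrans (esym (scaleE (dual_coaction T xi))).
rewrite !dual_coactionE; case: ifP => _; last by rewrite scaler0.
by rewrite !fctE ffunE.
Qed.

(** Operators of C do not mix arrows of different ranges. *)
Lemma corner_support T u (xi : {ffun G -> H}) : C T ->
  (forall x, u != r x -> xi x = 0) -> forall x, u != r x -> T xi x = 0.
Proof.
move=> CT xi0 x ux; have [lT _] := CT; rewrite entryE// big1// => y _.
have [xy|xy] := eqVneq (r x) (r y); last by rewrite corner_entry0.
by rewrite xi0 -?xy// (linear_map0 (entry_linear x y lT)).
Qed.

(** The initial projection of I keeps the (x, y) with s y = r x; an operator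
of C commutes with it since it preserves the range of x. *)
Lemma dual_coactionM S T : C T ->
  dual_coaction (S \o T) = dual_coaction S \o dual_coaction T.
Proof.
move=> CT; apply/funext => xi; apply/ffunP => y; apply/ffunP => x /=.
rewrite !dual_coactionE; case: ifP => // /eqP xy; congr (fun_of_fin (S _) x).
apply/ffunP => t; rewrite I23_adjE dual_coactionE; case: ifPn => [/eqP yt|yt].
  by rewrite gsrc_mul// eqxx gmulK.
apply: corner_support yt => // t' yt'.
by rewrite I23_adjE (negbTE yt').
Qed.

Lemma I23_adj_bounded : bounded_map (I23_adj (G := G) (H := H)).
Proof.
apply: bounded_map_ffun => y; apply: bounded_map_ffun => x; apply: bounded_map_if.
exact: bounded_map_comp (bounded_coord x) (bounded_coord (gmul y x)).
Qed.

Lemma dot_dual_coaction (T : {ffun G -> H} -> {ffun G -> H}) xi eta :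
  dot (dual_coaction T xi) eta =
  \sum_y dot (T (I23_adj xi y)) (I23_adj eta y).
Proof.
rewrite I23_adjP {1}/dot /=; apply: eq_bigr => y _.
by rewrite tens_idE.
Qed.

Lemma dual_coaction_adj (S T : {ffun G -> H} -> {ffun G -> H}) :
  is_adjoint S T -> is_adjoint (dual_coaction S) (dual_coaction T).
Proof.
move=> ST xi eta; rewrite dot_dual_coaction [RHS]dotC dot_dual_coaction.
by rewrite rmorph_sum; apply: eq_bigr => y _ /=; rewrite -dotC ST.
Qed.

(** The dual coaction is the sum of the sandwiches obtained by selecting each
value y of the second groupoid coordinate. *)
Lemma dual_coaction_normal : normal_on C (@dual_coaction R G H).
Proof.
pose P y (zeta : {ffun G -> H}) := I23 (coord_in y zeta).
pose Q y (xi : K) : {ffun G -> H} := I23_adj xi y.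
have PQ y zeta eta : dot (P y zeta) eta = dot zeta (Q y eta).
  by rewrite /P I23_adjP dotC -dot_coord_in -dotC.
have bQ y : bounded_map (Q y) := bounded_map_comp (bounded_coord y) I23_adj_bounded.
have bP y : bounded_map (P y).
  apply: bounded_map_ffun => y'; apply: bounded_map_ffun => x; apply: bounded_map_if.
  apply: (@bounded_map_comp _ _ _ _ (fun xi : K => xi (gmul y' (ginv x)) x)).
    exact: bounded_map_comp (bounded_coord x) (bounded_coord (gmul y' (ginv x))).
  exact: bounded_coord_in.
rewrite (_ : @dual_coaction R G H = fun T => \sum_y (P y \o T \o Q y)).
  apply: normal_sum => [y T CT|y].
    apply: (bounded_map_comp _ (bQ y)).
    exact: bounded_map_comp (bP y) (bounded_mem sC CT).
  exact: normal_sandwich (PQ y) (bQ y) (bQ y).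
apply/funext => T; apply/funext => xi; apply: dot_inj => eta.
rewrite dot_dual_coaction fct_sumE dot_suml; apply: eq_bigr => y _.
exact: esym (PQ _ _ _).
Qed.

Lemma dual_coaction_equalizer_vn :
  vn_subalgebra [set T | C T /\ dual_coaction T = dual_hom T].
Proof.
split; last first.
  exact: closed_equalizer corner_algebra_vn.2 dual_coaction_normal dual_hom_normal.
split.
- by move=> T [CT _]; exact: star_bounded sC _ CT.
- split; first exact: star0.
  by rewrite dual_hom0 -(scale0r 0) dual_coactionZ scale0r.
- move=> S T [CS dS] [CT dT]; split; first exact: starD.
  by rewrite dual_coactionD dual_homD// dS dT.
- move=> k T [CT dT]; split; first exact: starZ.
  by rewrite dual_coactionZ dual_homZ// dT.
- move=> S T [CS dS] [CT dT]; split; first exact: starM.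
  by rewrite dual_coactionM// dual_homM// dS dT.
- move=> T [CT dT]; have [S CS TS] := star_adj sC CT; exists S => //; split=> //.
  apply: (adjoint_unique (dual_coaction_adj TS)).
  by rewrite dT; exact: dual_hom_adj.
Qed.

Lemma delta_monomial a : A a ->
  delta a = monomial_op predT (translate ^~ a) id.
Proof.
by move=> Aa; apply/funext => xi; apply/ffunP => t; rewrite ffunE deltaE.
Qed.

Lemma delta_corner_monomial a : A a -> corner_monomial predT (translate ^~ a) id.
Proof.
by move=> Aa t _; split=> //; [exact: translate_in|exact: proj_comp_translate].
Qed.

Lemma e_rho_monomial x : e_bi b \o tens idfun (rho x) =
  monomial_op (fun t => s t == r x) (fun t => proj (r t)) (fun t => gmul t x).
Proof.
apply/funext => xi; apply/ffunP => t; rewrite /= e_biE !ffunE.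
case: ifPn => [/eqP tx|tx].
  rewrite (bigD1 (gmul t x))//= !ffunE tx !eqxx scale1r big1 ?addr0// => y yt.
  by rewrite !ffunE tx eqxx eq_sym (negbTE yt) scale0r.
rewrite big1 ?(linear_map0 (proj_linear _))// => y _.
by rewrite ffunE (negbTE tx) scale0r.
Qed.

Lemma rho_corner_monomial x :
  corner_monomial (fun t => s t == r x) (fun t => proj (r t)) (fun t => gmul t x).
Proof.
move=> t /eqP tx; split; [exact: proj_in| |exact: grng_mul].
by rewrite projM eqxx.
Qed.

Lemma e_mul_monomial f : e_bi b \o tens idfun (mulop f) =
  monomial_op predT (fun t => f t *: proj (r t)) id.
Proof.
apply/funext => xi; apply/ffunP => t; rewrite /= e_biE !ffunE /=.
rewrite (bigD1 t)//= big1 ?addr0 => [|y yt].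
  by rewrite !ffunE eqxx mulr1 (linear_mapZ _ _ (proj_linear _)).
by rewrite !ffunE eq_sym (negbTE yt) mulr0 scale0r.
Qed.

Lemma mul_corner_monomial (f : G -> R[i]) :
  corner_monomial predT (fun t => f t *: proj (r t)) id.
Proof.
move=> t _; split=> //; first by apply: starZ => //; exact: proj_in.
apply/funext => h; rewrite -[RHS]/(f t *: proj (r t) h) /=.
rewrite -[X in proj _ X]/(f t *: proj (r t) h) (linear_mapZ _ _ (proj_linear _)).
by rewrite -[X in _ *: X]/((proj (r t) \o proj (r t)) h) projM eqxx.
Qed.

(** On both sides the coefficient at (x, y) is delta_x(a), because
delta_{x y^-1} delta_y = delta_x. *)
Lemma dual_coaction_delta a : A a -> dual_coaction (delta a) = dual_hom (delta a).
Proof.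
move=> Aa; apply/funext => xi; apply/ffunP => y; apply/ffunP => x.
rewrite dual_coactionE {2}delta_monomial// dual_hom_monomial; last first.
  exact: delta_corner_monomial.
rewrite andbT; case: ifPn => // /eqP xy; rewrite deltaE// I23_adjE.
rewrite gsrc_mul ?grng_inv// gsrc_inv eqxx !gmulVK// translate_translate//.
by rewrite gsrc_mul ?grng_inv// gsrc_inv eqxx gmulVK.
Qed.

Lemma dual_coaction_e_rho g : dual_coaction (e_bi b \o tens idfun (rho g)) =
  dual_hom (e_bi b \o tens idfun (rho g)).
Proof.
rewrite e_rho_monomial; apply/funext => xi; apply/ffunP => y; apply/ffunP => x.
rewrite dual_coactionE dual_hom_monomial; last exact: rho_corner_monomial.
case: ifPn => //= /eqP xy; rewrite ffunE xy; case: ifPn => // /eqP yg.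
rewrite I23_adjE gsrc_mul ?grng_inv// gsrc_inv grng_mul ?xy// eqxx.
have yx : s (gmul y (ginv x)) = r x by rewrite gsrc_mul ?grng_inv// gsrc_inv.
have xy' : s (gmul x (ginv y)) = r y by rewrite gsrc_mul ?grng_inv// gsrc_inv.
rewrite translate_proj xy' eqxx grng_mul ?grng_inv//.
by rewrite [in LHS]gmulA ?xy// gmulVK// [in RHS]gmulA// gmulVK.
Qed.

Lemma dual_hom_e_mul f : dual_hom (e_bi b \o tens idfun (mulop f)) =
  dual_coaction (e_bi b) \o tens idfun (mulop f).
Proof.
rewrite e_mul_monomial; apply/funext => xi; apply/ffunP => y; apply/ffunP => x.
rewrite dual_hom_monomial; last exact: mul_corner_monomial.
rewrite /= dual_coactionE e_biE andbT; case: ifPn => // /eqP xy.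
rewrite I23_adjE gsrc_mul ?grng_inv// gsrc_inv eqxx !gmulVK//.
rewrite translateZ; last exact: proj_in.
rewrite translate_proj gsrc_mul ?grng_inv// gsrc_inv eqxx grng_mul ?grng_inv//.
rewrite ffunE (bigD1 y)//= big1 ?addr0 => [|z zy].
  by rewrite !ffunE eqxx mulr1 (linear_mapZ _ _ (proj_linear _)).
by rewrite !ffunE eq_sym (negbTE zy) mulr0 scale0r.
Qed.

(** * The double crossed product *)
Lemma cornerE : corner (delta idfun) (vn_tensor A (weyl_algebra R G)) = C.
Proof.
rewrite delta1 (@vn_tensorE _ _ _ (fun x y => r x == r y)); first last.
- exact: munit_weyl.
- exact: weyl_coeff.
- exact: vA.1.
- by move=> y x z /eqP -> /eqP ->.
- by move=> x y; rewrite eq_sym.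
apply/seteqP; split=> [_ [T [lT AT] <-]|T CT].
  have eE x y : entry (e_bi b \o T \o e_bi b) x y =
      proj (r x) \o entry T x y \o proj (r y).
    apply/funext => h; rewrite /entry /= e_biE; congr (proj _ (fun_of_fin (T _) _)).
    apply/ffunP => z; rewrite e_biE !ffunE; case: eqVneq => [->//|_].
    exact: linear_map0 (proj_linear _).
  split=> [k u v|x y].
    apply/ffunP => x; rewrite /= !e_biE.
    have -> : e_bi b (k *: u + v) = k *: e_bi b u + e_bi b v.
      by apply/ffunP => z; rewrite !ffunE !e_biE !ffunE proj_linear.
    by rewrite lT !ffunE !e_biE proj_linear.
  rewrite eE; split; last by rewrite -compA projM eqxx.
  split; last by rewrite -compA compA projM eqxx.
  apply: (starM sA); last exact: proj_in.
  by apply: (starM sA); [exact: proj_in|have [] := AT x y].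
have [lT _] := CT; exists T.
  split=> // x y; split; first exact: corner_entry.
  exact: corner_entry0.
apply/funext => xi; apply/ffunP => x; rewrite /= e_biE entryE// [RHS]entryE//.
rewrite (linear_map_sum _ _ (proj_linear _)); apply: eq_bigr => y _.
rewrite e_biE -[LHS]/((proj (r x) \o entry T x y \o proj (r y)) (xi y)).
rewrite corner_entryl//.
by have [_ /(_ x y)[_ ->]] := CT.
Qed.

(** The right-hand side is a von Neumann algebra containing the generators. *)
Lemma crossed_product_corner :
  crossed_product A b delta `<=` [set T | C T /\ dual_coaction T = dual_hom T].
Proof.
move=> T; apply; split; first exact: dual_coaction_equalizer_vn.
move=> _ [[a Aa <-]|[_ [c ->] <-]].
  split; last exact: dual_coaction_delta.
  by rewrite delta_monomial//; apply: monomial_corner; exact: delta_corner_monomial.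
rewrite (_ : _ \o _ = \sum_x c x *: (e_bi b \o tens idfun (rho x))).
  apply: star_sum dual_coaction_equalizer_vn.1 _ => x _.
  apply: (starZ dual_coaction_equalizer_vn.1); split; last exact: dual_coaction_e_rho.
  by rewrite e_rho_monomial; apply: monomial_corner; exact: rho_corner_monomial.
apply/funext => xi; apply/ffunP => x; rewrite /= e_biE [in RHS]fct_sumE.
rewrite [RHS]sum_ffunE ffunE; under [X in proj _ X]eq_bigr => y _.
  rewrite fct_sumE sum_ffunE scaler_suml; over.
rewrite exchange_big (linear_map_sum _ _ (proj_linear _)); apply: eq_bigr => g _.
rewrite [RHS]ffunE e_biE ffunE -(linear_mapZ _ _ (proj_linear _)) scaler_sumr.
congr (proj _ _); apply: eq_bigr => y _.
by rewrite scalerA !ffunE.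
Qed.

(** At the arrow x the three factors give p_{r x} delta_x(delta_{x^-1}(c)),
which is delta_{id (r x)}(c) = p_{r x} c, and x (x^-1 y) = y. *)
Lemma corner_matrix_unit c x y : A c -> proj (r x) \o c = c -> r x = r y ->
  tens c (munit x y) =
  (e_bi b \o tens idfun (mulop (chi R x))) \o delta (translate (ginv x) c) \o
  (e_bi b \o tens idfun (rho (gmul (ginv x) y))).
Proof.
move=> Ac pc xy; apply/funext => xi; apply/ffunP => z; rewrite tens_munitE.
rewrite e_rho_monomial e_mul_monomial delta_monomial; last exact: translate_in.
rewrite /= !ffunE /= /chi; case: eqVneq => [->|_]; last first.
  by rewrite -[RHS]/(0 *: proj (r z) _) scale0r.
rewrite grng_mul ?gsrc_inv// grng_inv eqxx gmulKV//.
rewrite -[RHS]/(1 *: proj (r x) _) scale1r translate_translate// grng_inv eqxx.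
rewrite gmulV -[X in proj _ X]/((translate (gid (r x)) c \o proj (r x)) (xi y)).
rewrite -comp_proj// -compA projM eqxx comp_proj// -proj_comp// pc /=.
by rewrite -[RHS]/((proj (r x) \o c) _) pc.
Qed.

(** The image contains the generators; conversely it is spanned by the images
of matrix units, which [corner_matrix_unit] writes as products of
generators. *)
Lemma double_crossed_productE : double_crossed_product A b delta = dual_hom @` C.
Proof.
apply/seteqP; split=> T.
  apply; split; first exact: dual_hom_image_vn.
  move=> _ [[z /crossed_product_corner[Cz dz] <-]|[_ [f _ <-] <-]].
    by exists z.
  exists (e_bi b \o tens idfun (mulop f)); last exact: dual_hom_e_mul.
  by rewrite e_mul_monomial; apply: monomial_corner; exact: mul_corner_monomial.
move=> [{}T CT <-] M [vM gM]; have sM := vM.1; have [lT _] := CT.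
(* N tracks membership in C as well, since dual_hom is only additive and
   multiplicative there. *)
pose N := [set S | C S /\ M (dual_hom S)].
suff : N T by case.
have ND S S' : N S -> N S' -> N (S + S').
  move=> [CS MS] [CS' MS']; split; first exact: starD.
  by rewrite dual_homD//; exact: starD.
have N0 : N 0 by split; [exact: star0|rewrite dual_hom0; exact: star0].
rewrite -(sum_tens_entry lT); apply: big_ind => // x _; apply: big_ind => // y _.
have [xy|xy] := eqVneq (r x) (r y); last first.
  rewrite corner_entry0// (_ : tens _ _ = 0)//.
  by apply/funext => xi; apply/ffunP => z; rewrite tens_munitE if_same ffunE.
have Ac := corner_entry x y CT.
rewrite corner_matrix_unit//; last exact: corner_entryl.
have NM S S' : N S -> N S' -> N (S \o S').
  move=> [CS MS] [CS' MS']; split; first exact: starM.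
  by rewrite dual_homM//; exact: starM.
have dualN S : crossed_product A b delta S -> N S.
  move=> cz; have [Cz dz] := crossed_product_corner cz; split=> //.
  by rewrite -dz; apply: gM; left; exists S.
apply: (NM); first apply: (NM).
- split; last first.
    rewrite dual_hom_e_mul; apply: gM; right.
    by exists (mulop (chi R x)) => //; exists (chi R x).
  by rewrite e_mul_monomial; apply: monomial_corner; exact: mul_corner_monomial.
- apply: dualN => P [_]; apply; left.
  by exists (translate (ginv x) (entry T x y)) => //; exact: translate_in.
- apply: dualN => P [_]; apply; right.
  by exists (rho (gmul (ginv x) y)) => //; exact: rho_in_algebra.
Qed.

Lemma dual_hom_star_hom : star_hom C (dual_hom @` C) dual_hom.
Proof.
split; [by move=> T CT; exists T|exact: dual_homD| | |exact: dual_hom_adj].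
- by move=> k T CT; exact: dual_homZ.
- exact: dual_homM.
Qed.

Lemma compress_star_hom : star_hom (dual_hom @` C) C compress.
Proof.
split.
- by move=> _ [T CT <-]; rewrite dual_homK.
- move=> S T _ _; apply/funext => xi; apply/ffunP => y.
  by rewrite /compress /= !ffunE.
- move=> k T _; apply/funext => xi; apply/ffunP => y.
  by rewrite /compress /= !ffunE.
- by move=> _ _ [S CS <-] [T CT <-]; rewrite -dual_homM// !dual_homK//; exact: starM.
- move=> S T _ _ ST xi eta; rewrite /compress /= dot_diag_out ST.
  by rewrite dotC -dot_diag_out -dotC.
Qed.

Lemma double_crossed_product_isomorphic :
  vn_isomorphic (double_crossed_product A b delta)
    (corner (delta idfun) (vn_tensor A (weyl_algebra R G))).
Proof.
rewrite double_crossed_productE cornerE; exists compress, dual_hom; split.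
- exact: compress_star_hom.
- exact: compress_normal.
- exact: dual_hom_star_hom.
- exact: dual_hom_normal.
- by split=> [_ [T CT <-]|T CT]; rewrite !dual_homK.
Qed.

End Action.

Theorem theorem3p5p2 (R : realType) (G : finGroupoid) (H : hilbertType R)
    (A : set (H -> H)) (b : (gobj G -> R[i]) -> (H -> H))
    (delta : (H -> H) -> ({ffun G -> H} -> {ffun G -> H})) :
  vn_algebra A -> unital_faithful_rep A b -> right_action A b delta ->
  vn_isomorphic (double_crossed_product A b delta)
    (corner (delta idfun) (vn_tensor A (weyl_algebra R G))) /\
  weyl_algebra R G = vn_generated (mult_algebra R G `|` rho_algebra R G).
Proof.
move=> vA rep act; split; last exact: weyl_generated.
exact: double_crossed_product_isomorphic.
Qed.
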